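(* Assume that $\varphi=\{\varphi_n(r)\}_{n=0}^{\infty}$ belongs to $\mathcal{F}$ and is such that $\varphi_0(r)=1$ and $$\varphi_{m+n}(r)\le\varphi_m(r)\varphi_n(r)\quad\text{for all } m,n\ge0 \text{ and } r\in[0,1).$$ If $f(z)=\sum_{k=0}^{\infty}a_kz^k$ and $g(z)=\sum_{k=0}^{\infty}b_kz^k$ are analytic in $\mathbb{D}$ and $f\prec_q g$ in $\mathbb{D}$, then $$\sum_{k=0}^{\infty}|a_k|\varphi_k(r)\le\sum_{k=0}^{\infty}|b_k|\varphi_k(r)\quad\text{for all } r\le R,$$ where $R$ is the minimal positive root of the equation $1=2\Phi_1(x)$, with $\Phi_1(x)=\sum_{n=1}^{\infty}\varphi_n(x)$.
   Context: $\mathbb{D}=\{z\in\mathbb{C}:|z|<1\}$ is the open unit disk. $\mathcal{B}$ is the set of analytic functions $f$ on $\mathbb{D}$ with $\sup_{z\in\mathbb{D}}|f(z)|\le1$. $\mathcal{F}$ is the set of all sequences $\{\varphi_n(r)\}_{n=0}^{\infty}$ of nonnegative continuous functions on $[0,1)$ such that the series $\sum_{n=0}^{\infty}\varphi_n(r)$ converges locally uniformly with respect to $r\in[0,1)$. For analytic functions $f$ and $g$ in $\mathbb{D}$, $f$ is quasi-subordinate to $g$, written $f\prec_q g$ in $\mathbb{D}$, if there exist two functions $W\in\mathcal{B}$ and $\omega\in\mathcal{B}$ with $\omega(0)=0$ such that $f(z)=W(z)g(\omega(z))$ for $z\in\mathbb{D}$.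
   Formalization: Adds the hypothesis 2Φ₁(x)<1 for 0<x<R; without it the claim is false (φ_n(r)=(0.9−0.8r)^n, R=17/24, g=1, f=(0.9−z)/(1−0.9z), r=0 gives 1.8>1). *)

(* Defs.v *)
From Stdlib Require Import Reals.
From Coquelicot Require Import Coquelicot.

(* Stdlib reals with Coquelicot.  Functions on the disk are total functions
   C -> C; only their values at points z with Cmod z < 1 are ever constrained. *)

Open Scope R_scope.

(* The structures are given explicitly because C also carries a NormedModule
   structure over R in Coquelicot. *)
Definition C_pseries_sum (a : nat -> C) (z l : C) : Prop :=
  @is_pseries C_AbsRing C_NormedModule a z l.

Definition unit_disk (z : C) : Prop := Cmod z < 1.

Definition analytic_at (f : C -> C) (z0 : C) : Prop :=
  exists (c : nat -> C) (rho : R),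
    0 < rho /\
    forall z : C, Cmod (z - z0)%C < rho -> C_pseries_sum c (z - z0)%C (f z).

Definition analytic_in_disk (f : C -> C) : Prop :=
  forall z0 : C, unit_disk z0 -> analytic_at f z0.

Definition class_B (f : C -> C) : Prop :=
  analytic_in_disk f /\ forall z : C, unit_disk z -> Cmod (f z) <= 1.

Definition quasi_subordinate (f g : C -> C) : Prop :=
  exists W omega : C -> C,
    class_B W /\ class_B omega /\ omega (RtoC 0) = RtoC 0 /\
    forall z : C, unit_disk z -> f z = (W z * g (omega z))%C.

Definition Ico01 (r : R) : Prop := 0 <= r < 1.

(* Neighbourhoods are taken relative to [0,1).  CVU_dom, whose limit is written
   with the total operator Lim_seq, does entail pointwise convergence: partial
   sums that stay eventually within every eps of a fixed real converge to it. *)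
Definition series_cv_locally_uniformly (phi : nat -> R -> R) : Prop :=
  forall r : R, Ico01 r ->
    exists delta : R, 0 < delta /\
      CVU_dom (fun N x => sum_n (fun n => phi n x) N)
              (fun x => Ico01 x /\ Rabs (x - r) < delta).

Definition class_F (phi : nat -> R -> R) : Prop :=
  (forall (n : nat) (r : R), Ico01 r -> 0 <= phi n r) /\
  (forall n : nat, continuous_on Ico01 (phi n)) /\
  series_cv_locally_uniformly phi.

Definition Phi1 (phi : nat -> R -> R) (x : R) : R :=
  Series (fun n => phi (S n) x).

(* The phi n live on [0,1), so a positive root is a root in (0,1). *)
Definition positive_root (phi : nat -> R -> R) (x : R) : Prop :=
  0 < x < 1 /\ 1 = 2 * Phi1 phi x.

Definition minimal_positive_root (phi : nat -> R -> R) (x : R) : Prop :=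
  positive_root phi x /\ forall y : R, positive_root phi y -> x <= y.

(* Main.v *)
Require Import Defs.
From Stdlib Require Import Reals Lra Lia ClassicalEpsilon.
From Coquelicot Require Import Coquelicot.

(** Write f(z) = W(z) g(omega(z)) and put H_k(z) = W(z) (omega(z)/z)^k.
    Expanding g gives f = sum_k b_k z^k H_k, so that with H_k = sum_j c_(k,j) z^j

      a_n = sum_(k <= n) b_k c_(k,n-k).

    Since phi_(k+j) <= phi_k phi_j, the sum of the |a_n| phi_n is at most the
    sum over k of |b_k| phi_k (sum_j |c_(k,j)| phi_j), and it is enough to bound
    each inner factor by 1.  Now H_k extends to an analytic function bounded by
    1 (Schwarz), and for such a function |c_n| <= 2 (1 - |c_0|) when n >= 1.
    Hence, as 2 Phi_1(r) <= 1 for r <= R,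

      sum_j |c_j| phi_j(r) <= |c_0| + 2 (1 - |c_0|) Phi_1(r) <= 1.

    The estimate 2|c_0| + |c_n| <= 2 [coef_bound] is weaker than the sharp
    |c_n| <= 1 - |c_0|^2, but it is exactly what the constant 2 in 1 = 2 Phi_1
    needs, and it is linear in H: it comes from averaging H over a circle
    against the nonnegative Fejer-type weight |1 + mu|^2 = 2 + mu + conj(mu),
    where mu = conj(l) (z/r)^n and |l| = 1 [Fejer_average_bound].

    The global input is that circle means of a function analytic in a punctured
    disk do not depend on the radius.  Integrals are replaced by averages over
    roots of unity.  If zeta is a primitive N-th root of unity and
    q = exp(-2 pi/N), then q z - z = lambda (zeta z - z) for a fixed lambda, so,
    to first order, K(q z) - K(z) = lambda (K(zeta z) - K(z)); the right-hand
    side has average 0 over the N points because zeta permutes them.  Shrinking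
    the radius by the factor exp(-2 pi L) takes L N such steps, each with an
    error o(1/N), uniformly by compactness; the total error tends to 0
    [avg_radius_independent].  Strict differentiability is the form of
    analyticity which this argument uses: it follows from a local power series
    and is preserved by products and by inversion away from 0, so it passes to
    H_k without any power series for H_k at points other than 0.

    At the origin only finite expansions are used [expands].  Averages over
    small circles read off their coefficients [avg_extracts_coef].  The bound
    |H_k| <= 1 enters as |H_k(z)| |z|^k <= 1, which is immediate from
    |W|, |omega| <= 1 and becomes the same thing when the radius of the outer
    circle tends to 1.

    The rearrangement of the double sum is replaced by an induction on the
    number of terms [majorant_comparison], which peels off b_0 through
    H_k g(omega) = b_0 H_k + z H_(k+1) g_1(omega), where g(w) = b_0 + w g_1(w)
    [twisted_compose_step]. *)

(** * Finite sums *)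

Lemma sum_n_Cplus (F : nat -> C) (n : nat) :
  sum_n F (S n) = (sum_n F n + F (S n))%C :> C.
Proof. now rewrite sum_Sn. Qed.

Lemma sum_n_Rplus (u : nat -> R) (n : nat) :
  sum_n u (S n) = sum_n u n + u (S n) :> R.
Proof. now rewrite sum_Sn. Qed.

Lemma sum_n_first {G : AbelianMonoid} (u : nat -> G) (n : nat) :
  sum_n u (S n) = plus (u 0%nat) (sum_n (fun k => u (S k)) n).
Proof.
  unfold sum_n. rewrite sum_Sn_m; [|apply Nat.le_0_l]. now rewrite sum_n_m_S.
Qed.

Lemma sum_n_Cmult_l (c : C) (F : nat -> C) (n : nat) :
  sum_n (fun j => (c * F j)%C) n = (c * sum_n F n)%C :> C.
Proof.
  induction n as [|n IH]; [now rewrite !sum_O|].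
  rewrite !sum_n_Cplus, IH. ring.
Qed.

Lemma sum_n_Cadd (F G : nat -> C) (n : nat) :
  sum_n (fun j => (F j + G j)%C) n = (sum_n F n + sum_n G n)%C :> C.
Proof.
  induction n as [|n IH]; [now rewrite !sum_O|].
  rewrite !sum_n_Cplus, IH. ring.
Qed.

Lemma Cmod_sum_n_le (F : nat -> C) (u : nat -> R) (n : nat) :
  (forall j, (j <= n)%nat -> Cmod (F j) <= u j) ->
  Cmod (sum_n F n) <= sum_n u n.
Proof.
  induction n as [|n IH]; intros H.
  - rewrite !sum_O. now apply H.
  - rewrite sum_n_Cplus, sum_n_Rplus.
    eapply Rle_trans; [apply Cmod_triangle|].
    apply Rplus_le_compat; [|now apply H].
    apply IH. intros j Hj. apply H. lia.
Qed.

Lemma Cmod_sum_n_le_const (F : nat -> C) (B : R) (n : nat) :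
  (forall j, (j <= n)%nat -> Cmod (F j) <= B) ->
  Cmod (sum_n F n) <= INR (S n) * B.
Proof.
  intros H. eapply Rle_trans; [now apply (Cmod_sum_n_le F (fun _ => B))|].
  rewrite sum_n_const. apply Rle_refl.
Qed.

Lemma sum_n_Rle (u v : nat -> R) (n : nat) :
  (forall j, (j <= n)%nat -> u j <= v j) -> sum_n u n <= sum_n v n.
Proof.
  induction n as [|n IH]; intros H.
  - rewrite !sum_O. now apply H.
  - rewrite !sum_n_Rplus. apply Rplus_le_compat; [|now apply H].
    apply IH. intros j Hj. apply H. lia.
Qed.

Lemma sum_n_Rmult_l (c : R) (u : nat -> R) (n : nat) :
  sum_n (fun j => c * u j) n = c * sum_n u n :> R.
Proof.
  induction n as [|n IH]; [now rewrite !sum_O|].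
  rewrite !sum_n_Rplus, IH. ring.
Qed.

Lemma sum_n_Radd (u v : nat -> R) (n : nat) :
  sum_n (fun j => u j + v j) n = sum_n u n + sum_n v n :> R.
Proof.
  induction n as [|n IH]; [now rewrite !sum_O|].
  rewrite !sum_n_Rplus, IH. ring.
Qed.

Lemma Cmod_sub_le (z w : C) : Cmod (z - w) <= Cmod z + Cmod w.
Proof.
  unfold Cminus. rewrite <- (Cmod_opp w). apply Cmod_triangle.
Qed.

Lemma Cmod_eq_0_of_small (z : C) :
  (forall eps, 0 < eps -> Cmod z <= eps) -> z = 0.
Proof.
  intros H. apply Cmod_eq_0. apply Rle_antisym; [|apply Cmod_ge_0].
  apply le_epsilon. intros e He. rewrite Rplus_0_l. now apply H.
Qed.

(** * Power series *)

Lemma C_pow_n (z : C) (k : nat) : @pow_n C_Ring z k = (z ^ k)%C.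
Proof.
  induction k as [|k IH]; [reflexivity|].
  simpl. rewrite IH. reflexivity.
Qed.

(** The topology on complex numbers behind [is_pseries] is that of the product,
    hence the factor sqrt 2 when passing to the modulus. *)
Lemma C_pseries_partial_sums (c : nat -> C) (z l : C) :
  C_pseries_sum c z l ->
  forall eps, 0 < eps -> exists N, forall n, (N <= n)%nat ->
    Cmod (sum_n (fun k => (c k * z ^ k)%C) n - l) <= eps.
Proof.
  intros H eps Heps.
  unfold C_pseries_sum, is_pseries, is_series in H.
  assert (Hs : 0 < sqrt 2) by (apply sqrt_lt_R0; lra).
  assert (He : 0 < eps / sqrt 2) by (apply Rdiv_lt_0_compat; assumption).
  destruct (proj1 (filterlim_locally _ _) H (mkposreal _ He)) as [N HN].
  exists N. intros n Hn. specialize (HN n Hn).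
  apply C_NormedModule_mixin_compat2 in HN. simpl in HN.
  replace (sqrt 2 * (eps / sqrt 2)) with eps in HN by (field; lra).
  apply Rlt_le. eapply Rle_lt_trans; [|exact HN].
  apply Req_le.
  rewrite (sum_n_ext (fun k => scal (pow_n z k) (c k)) (fun k => (c k * z ^ k)%C));
    [reflexivity|].
  intros k. transitivity (@pow_n C_Ring z k * c k)%C; [reflexivity|].
  rewrite C_pow_n. apply Cmult_comm.
Qed.

Lemma C_pseries_at_0 (c : nat -> C) (l : C) : C_pseries_sum c 0 l -> l = c 0%nat.
Proof.
  intros H.
  assert (Hc : forall n, sum_n (fun k => (c k * 0 ^ k)%C) n = c 0%nat :> C).
  { induction n as [|n IH].
    - rewrite sum_O. simpl. ring.
    - rewrite sum_n_Cplus, IH, Cpow_S. ring. }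
  assert (E : (c 0%nat - l)%C = 0).
  { apply Cmod_eq_0_of_small. intros eps Heps.
    destruct (C_pseries_partial_sums _ _ _ H eps Heps) as [N HN].
    specialize (HN N (le_n N)). now rewrite Hc in HN. }
  replace l with (c 0%nat - (c 0%nat - l))%C by ring. rewrite E. ring.
Qed.

Lemma C_pseries_terms_bounded (c : nat -> C) (z l : C) :
  C_pseries_sum c z l -> exists M, forall k, Cmod (c k) * Cmod z ^ k <= M.
Proof.
  intros H. destruct (C_pseries_partial_sums _ _ _ H 1 Rlt_0_1) as [N HN].
  assert (HB : exists B, forall k, (k <= N)%nat -> Cmod (c k) * Cmod z ^ k <= B).
  { clear. induction N as [|N [B HB]].
    - exists (Cmod (c 0%nat) * Cmod z ^ 0). intros k Hk.
      replace k with 0%nat by lia. lra.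
    - exists (Rmax B (Cmod (c (S N)) * Cmod z ^ S N)). intros k Hk.
      destruct (Nat.eq_dec k (S N)) as [->|Hne]; [apply Rmax_r|].
      eapply Rle_trans; [apply HB; lia|apply Rmax_l]. }
  destruct HB as [B HB]. exists (Rmax B 2). intros k.
  destruct (Nat.le_gt_cases k N) as [Hk|Hk].
  - eapply Rle_trans; [now apply HB|apply Rmax_l].
  - eapply Rle_trans; [|apply Rmax_r].
    destruct k as [|k]; [lia|].
    rewrite <- Cmod_pow, <- Cmod_mult.
    assert (H1 := HN k ltac:(lia)). assert (H2 := HN (S k) ltac:(lia)).
    rewrite sum_n_Cplus in H2.
    set (s := sum_n (fun k : nat => (c k * z ^ k)%C) k) in *.
    replace (c (S k) * z ^ S k)%C
      with ((s + c (S k) * z ^ S k - l) - (s - l))%C by ring.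
    eapply Rle_trans; [apply Cmod_sub_le|]. lra.
Qed.

Lemma C_pseries_tail (c : nat -> C) (z l : C) :
  C_pseries_sum c z l ->
  exists l1, l = (c 0%nat + z * l1)%C /\ C_pseries_sum (fun k => c (S k)) z l1.
Proof.
  intros H. destruct (excluded_middle_informative (z = 0)) as [->|Hz].
  - exists (c 1%nat). split.
    + rewrite (C_pseries_at_0 _ _ H). ring.
    + exact (is_pseries_0 (fun k => c (S k))).
  - exists (/ z * (l + - c 0%nat))%C. split; [now field|].
    refine (is_pseries_decr_1 c z (/ z)%C l _ H).
    now apply Cinv_l.
Qed.

Lemma sum_geom_half_le (n : nat) : sum_n (fun k => (/ 2) ^ k) n <= 2.
Proof.
  assert (H : sum_n (fun k => (/ 2) ^ k) n = 2 - (/ 2) ^ n :> R).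
  { induction n as [|n IH]; [rewrite sum_O; simpl; lra|].
    rewrite sum_n_Rplus, IH. simpl. lra. }
  rewrite H. assert (0 < (/ 2) ^ n) by (apply pow_lt; lra). lra.
Qed.

Lemma C_limit_le (u : nat -> C) (l : C) (B : R) :
  (forall eps, 0 < eps -> exists N, forall n, (N <= n)%nat -> Cmod (u n - l) <= eps) ->
  (forall n, Cmod (u n) <= B) -> Cmod l <= B.
Proof.
  intros Hl HB. apply le_epsilon. intros eps Heps.
  destruct (Hl eps Heps) as [N HN]. specialize (HN N (le_n N)).
  replace l with (u N - (u N - l))%C by ring.
  eapply Rle_trans; [apply Cmod_sub_le|]. specialize (HB N). lra.
Qed.

(** The terms are bounded at the point rho/2, so at |z| < rho/4 the series is
    dominated by a geometric series of ratio 1/2. *)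
Lemma C_pseries_bounded (c : nat -> C) (F : C -> C) (rho : R) :
  0 < rho -> (forall z, Cmod z < rho -> C_pseries_sum c z (F z)) ->
  exists M, forall z, Cmod z < rho / 4 -> Cmod (F z) <= M.
Proof.
  intros Hrho H.
  assert (Hm : Cmod (RtoC (rho / 2)) = rho / 2) by (rewrite Cmod_R, Rabs_pos_eq; lra).
  destruct (C_pseries_terms_bounded c (RtoC (rho / 2)) (F (RtoC (rho / 2)))) as [M HM].
  { apply H. lra. }
  rewrite Hm in HM.
  exists (M * 2). intros z Hz.
  apply (C_limit_le _ _ _ (C_pseries_partial_sums _ _ _ (H z ltac:(lra)))).
  intros n.
  eapply Rle_trans; [apply (Cmod_sum_n_le _ (fun k => M * (/ 2) ^ k))|].
  - intros k _. rewrite Cmod_mult, Cmod_pow.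
    apply Rle_trans with (Cmod (c k) * (rho / 2 * / 2) ^ k).
    + apply Rmult_le_compat_l; [apply Cmod_ge_0|].
      apply pow_incr. split; [apply Cmod_ge_0|lra].
    + rewrite Rpow_mult_distr, <- Rmult_assoc.
      apply Rmult_le_compat_r; [apply pow_le; lra|apply HM].
  - rewrite sum_n_Rmult_l. apply Rmult_le_compat_l; [|apply sum_geom_half_le].
    eapply Rle_trans; [|apply (HM 0%nat)]. simpl. rewrite Rmult_1_r. apply Cmod_ge_0.
Qed.
(** The tail exists at each point; a choice turns it into a function. *)
Lemma C_pseries_tail_fun (P : C -> Prop) (c : nat -> C) (F : C -> C) :
  (forall z, P z -> C_pseries_sum c z (F z)) ->
  exists F1 : C -> C, forall z, P z ->
    F z = (c 0%nat + z * F1 z)%C /\ C_pseries_sum (fun k => c (S k)) z (F1 z).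
Proof.
  intros H.
  exists (fun z => epsilon (inhabits (RtoC 0)) (fun l1 =>
    F z = (c 0%nat + z * l1)%C /\ C_pseries_sum (fun k => c (S k)) z l1)).
  intros z Hz. apply epsilon_spec. now apply C_pseries_tail, H.
Qed.

(** A crude form of |z^k - w^k| <= k s^(k-1) |z - w| in which the polynomial
    factor is absorbed into 2^k, so that a geometric series dominates. *)
Lemma Cmod_pow_diff (s : R) (z w : C) (k : nat) :
  Cmod z <= s -> Cmod w <= s ->
  Cmod (z ^ k - w ^ k) * s <= (2 * s) ^ k * Cmod (z - w).
Proof.
  intros Hz Hw. assert (Hs : 0 <= s) by (pose proof (Cmod_ge_0 z); lra).
  induction k as [|k IH].
  - simpl. replace (1 - 1)%C with (RtoC 0) by ring. rewrite Cmod_0.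
    pose proof (Cmod_ge_0 (z - w)). lra.
  - rewrite !Cpow_S.
    replace (z * z ^ k - w * w ^ k)%C with (z * (z ^ k - w ^ k) + (z - w) * w ^ k)%C by ring.
    eapply Rle_trans; [apply Rmult_le_compat_r; [exact Hs|apply Cmod_triangle]|].
    rewrite !Cmod_mult, Cmod_pow.
    assert (H1 : Cmod w ^ k <= (2 * s) ^ k).
    { apply pow_incr. split; [apply Cmod_ge_0|lra]. }
    pose proof (Cmod_ge_0 (z - w)) as H2. pose proof (Cmod_ge_0 (z ^ k - w ^ k)) as H3.
    simpl.
    apply Rle_trans with (s * ((2 * s) ^ k * Cmod (z - w)) + Cmod (z - w) * (2 * s) ^ k * s).
    + rewrite Rmult_plus_distr_r. apply Rplus_le_compat.
      * rewrite Rmult_assoc. apply Rmult_le_compat; try assumption.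
        -- apply Cmod_ge_0.
        -- apply Rmult_le_pos; assumption.
      * apply Rmult_le_compat_r; [exact Hs|]. now apply Rmult_le_compat_l.
    + apply Req_le. ring.
Qed.

(** With s = rho/8 in [Cmod_pow_diff], the k-th term is at most a constant times
    (rho/4)^k |c_k|, again geometric of ratio 1/2 by the bound at rho/2. *)
Lemma C_pseries_lipschitz (c : nat -> C) (F : C -> C) (rho : R) :
  0 < rho -> (forall z, Cmod z < rho -> C_pseries_sum c z (F z)) ->
  exists L, 0 <= L /\ forall z w, Cmod z < rho / 8 -> Cmod w < rho / 8 ->
    Cmod (F z - F w) <= L * Cmod (z - w).
Proof.
  intros Hrho H.
  assert (Hm : Cmod (RtoC (rho / 2)) = rho / 2) by (rewrite Cmod_R, Rabs_pos_eq; lra).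
  destruct (C_pseries_terms_bounded c (RtoC (rho / 2)) (F (RtoC (rho / 2)))) as [M HM].
  { apply H. lra. }
  rewrite Hm in HM.
  assert (HM0 : 0 <= M).
  { eapply Rle_trans; [|apply (HM 0%nat)]. simpl. rewrite Rmult_1_r. apply Cmod_ge_0. }
  exists (M * 2 * (8 / rho)). split.
  { apply Rmult_le_pos; [lra|]. apply Rlt_le, Rdiv_lt_0_compat; lra. }
  intros z w Hz Hw.
  apply (C_limit_le (fun n => sum_n (fun k => (c k * z ^ k)%C) n
                              - sum_n (fun k => (c k * w ^ k)%C) n)%C).
  - intros eps Heps.
    destruct (C_pseries_partial_sums _ _ _ (H z ltac:(lra)) (eps / 2) ltac:(lra)) as [N1 H1].
    destruct (C_pseries_partial_sums _ _ _ (H w ltac:(lra)) (eps / 2) ltac:(lra)) as [N2 H2].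
    exists (Nat.max N1 N2). intros n Hn.
    specialize (H1 n ltac:(lia)). specialize (H2 n ltac:(lia)).
    replace (sum_n (fun k => (c k * z ^ k)%C) n - sum_n (fun k => (c k * w ^ k)%C) n - (F z - F w))%C
      with ((sum_n (fun k => (c k * z ^ k)%C) n - F z) - (sum_n (fun k => (c k * w ^ k)%C) n - F w))%C
      by ring.
    eapply Rle_trans; [apply Cmod_sub_le|]. lra.
  - intros n.
    assert (E : (sum_n (fun k => (c k * z ^ k)%C) n - sum_n (fun k => (c k * w ^ k)%C) n)%C
                = sum_n (fun k => (c k * (z ^ k - w ^ k))%C) n :> C).
    { induction n as [|n IH]; [rewrite !sum_O; simpl; ring|].
      rewrite !sum_n_Cplus, <- IH. ring. }
    rewrite E.
    eapply Rle_trans;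
      [apply (Cmod_sum_n_le _ (fun k => (M * (8 / rho) * Cmod (z - w)) * (/ 2) ^ k))|].
    + intros k _. rewrite Cmod_mult.
      pose proof (Cmod_pow_diff (rho / 8) z w k ltac:(lra) ltac:(lra)) as HP.
      apply Rmult_le_reg_r with (rho / 8); [lra|].
      rewrite Rmult_assoc.
      eapply Rle_trans; [apply Rmult_le_compat_l; [apply Cmod_ge_0|exact HP]|].
      replace (2 * (rho / 8)) with (rho / 2 * / 2) by field.
      rewrite Rpow_mult_distr.
      replace (M * (8 / rho) * Cmod (z - w) * (/ 2) ^ k * (rho / 8))
        with (M * ((/ 2) ^ k * Cmod (z - w))) by (field; lra).
      rewrite <- !Rmult_assoc, (Rmult_assoc (_ * _)).
      rewrite (Rmult_assoc M).
      apply Rmult_le_compat_r; [|apply HM].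
      apply Rmult_le_pos; [apply pow_le; lra|apply Cmod_ge_0].
    + rewrite sum_n_Rmult_l.
      replace (M * 2 * (8 / rho) * Cmod (z - w)) with (M * (8 / rho) * Cmod (z - w) * 2) by ring.
      apply Rmult_le_compat_l; [|apply sum_geom_half_le].
      apply Rmult_le_pos; [|apply Cmod_ge_0].
      apply Rmult_le_pos; [exact HM0|]. apply Rlt_le, Rdiv_lt_0_compat; lra.
Qed.

(** * Strict differentiability *)

(** Both points vary around [z0] while the derivative is that at [z0].  This is
    stronger than differentiability, and it makes the approximation uniform near
    each centre, as needed for compactness. *)
Definition strictly_diff (F : C -> C) (z0 : C) : Prop :=
  exists D : C, forall eps, 0 < eps -> exists d, 0 < d /\
    forall z w, Cmod (z - z0) < d -> Cmod (w - z0) < d ->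
      Cmod (F z - F w - D * (z - w)) <= eps * Cmod (z - w).

(** Two steps of the series give F = c_0 + u (c_1 + u F_2) with u = z - z_0, and
    u^2 F_2(u) - v^2 F_2(v) = (u - v) (u + v) F_2(u) + v^2 (F_2(u) - F_2(v)) is
    small compared with u - v, because F_2 is bounded and Lipschitz near 0. *)
Lemma analytic_strictly_diff (F : C -> C) (z0 : C) :
  analytic_at F z0 -> strictly_diff F z0.
Proof.
  intros (c & rho & Hrho & H).
  assert (H0 : forall u, Cmod u < rho -> C_pseries_sum c u (F (z0 + u)%C)).
  { intros u Hu. specialize (H (z0 + u)%C).
    replace (z0 + u - z0)%C with u in H by ring. now apply H. }
  destruct (C_pseries_tail_fun (fun u => Cmod u < rho) _ _ H0) as [F1 H1].
  destruct (C_pseries_tail_fun (fun u => Cmod u < rho) _ F1 (fun u Hu => proj2 (H1 u Hu)))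
    as [F2 H2].
  assert (H2' := fun u Hu => proj2 (H2 u Hu)). simpl in H2'.
  destruct (C_pseries_bounded _ F2 rho Hrho H2') as [M HM].
  destruct (C_pseries_lipschitz _ F2 rho Hrho H2') as (L & HL0 & HL).
  exists (c 1%nat). intros eps Heps.
  assert (HM0 : 0 <= M).
  { eapply Rle_trans; [apply Cmod_ge_0|apply (HM (RtoC 0))]. rewrite Cmod_0. lra. }
  set (T := 2 * M + L + 1).
  assert (HT : 0 < T) by (unfold T; lra).
  set (d := Rmin (Rmin 1 (rho / 8)) (eps / T)).
  assert (Hd : 0 < d /\ d <= 1 /\ d <= rho / 8 /\ d * T <= eps).
  { unfold d. repeat split.
    - repeat apply Rmin_pos; try lra. now apply Rdiv_lt_0_compat.
    - eapply Rle_trans; [apply Rmin_l|apply Rmin_l].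
    - eapply Rle_trans; [apply Rmin_l|apply Rmin_r].
    - apply Rle_trans with (eps / T * T); [|right; field; lra].
      apply Rmult_le_compat_r; [lra|apply Rmin_r]. }
  exists d. split; [tauto|]. intros z w Hz Hw.
  set (u := (z - z0)%C) in *. set (v := (w - z0)%C) in *.
  assert (E : forall x, Cmod x < d -> F (z0 + x)%C = (c 0%nat + x * (c 1%nat + x * F2 x))%C).
  { intros x Hx. rewrite (proj1 (H1 x ltac:(lra))), (proj1 (H2 x ltac:(lra))). reflexivity. }
  replace z with (z0 + u)%C by (unfold u; ring).
  replace w with (z0 + v)%C by (unfold v; ring).
  rewrite !E by assumption.
  replace (z0 + u - (z0 + v))%C with (u - v)%C by ring.
  replace (c 0%nat + u * (c 1%nat + u * F2 u) - (c 0%nat + v * (c 1%nat + v * F2 v))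
           - c 1%nat * (u - v))%C
    with ((u - v) * ((u + v) * F2 u) + v * v * (F2 u - F2 v))%C by ring.
  eapply Rle_trans; [apply Cmod_triangle|]. rewrite !Cmod_mult.
  pose proof (HM u ltac:(lra)) as B1. pose proof (HL u v ltac:(lra) ltac:(lra)) as B2.
  pose proof (Cmod_triangle u v) as B3. pose proof (Cmod_ge_0 (u - v)) as P1.
  pose proof (Cmod_ge_0 (F2 u)) as P2. pose proof (Cmod_ge_0 (u + v)) as P3.
  pose proof (Cmod_ge_0 v) as P4. pose proof (Cmod_ge_0 (F2 u - F2 v)) as P5.
  assert (Q1 : Cmod (u + v) * Cmod (F2 u) <= 2 * d * M).
  { apply Rmult_le_compat; lra. }
  assert (Q2 : Cmod v * Cmod v <= d * 1).
  { apply Rmult_le_compat; lra. }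
  assert (Q3 : Cmod v * Cmod v * Cmod (F2 u - F2 v) <= d * 1 * (L * Cmod (u - v))).
  { apply Rmult_le_compat; try assumption. now apply Rmult_le_pos. }
  assert (Q4 : Cmod (u - v) * (Cmod (u + v) * Cmod (F2 u)) <= Cmod (u - v) * (2 * d * M)).
  { now apply Rmult_le_compat_l. }
  apply Rle_trans with (d * T * Cmod (u - v)); [|apply Rmult_le_compat_r; tauto].
  apply Rle_trans with (Cmod (u - v) * (2 * d * M) + d * 1 * (L * Cmod (u - v))); [lra|].
  unfold T. assert (0 <= d * Cmod (u - v)) by (apply Rmult_le_pos; lra).
  replace (d * (2 * M + L + 1) * Cmod (u - v)) with
   (Cmod (u - v) * (2 * d * M) + d * 1 * (L * Cmod (u - v)) + d * Cmod (u - v)) by ring.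
  lra.
Qed.

Lemma strictly_diff_const (a z0 : C) : strictly_diff (fun _ => a) z0.
Proof.
  exists (RtoC 0). intros eps Heps. exists 1. split; [lra|]. intros z w _ _.
  replace (a - a - 0 * (z - w))%C with (RtoC 0) by ring. rewrite Cmod_0.
  apply Rmult_le_pos; [lra|apply Cmod_ge_0].
Qed.

Lemma strictly_diff_id (z0 : C) : strictly_diff (fun z => z) z0.
Proof.
  exists (RtoC 1). intros eps Heps. exists 1. split; [lra|]. intros z w _ _.
  replace (z - w - 1 * (z - w))%C with (RtoC 0) by ring. rewrite Cmod_0.
  apply Rmult_le_pos; [lra|apply Cmod_ge_0].
Qed.

Lemma strictly_diff_plus (F G : C -> C) (z0 : C) :
  strictly_diff F z0 -> strictly_diff G z0 ->
  strictly_diff (fun z => F z + G z)%C z0.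
Proof.
  intros (D & HD) (E & HE). exists (D + E)%C. intros eps Heps.
  destruct (HD (eps / 2) ltac:(lra)) as (d & Hd & H1).
  destruct (HE (eps / 2) ltac:(lra)) as (e & He & H2).
  exists (Rmin d e). split; [now apply Rmin_pos|]. intros z w Hz Hw.
  pose proof (Rmin_l d e). pose proof (Rmin_r d e).
  specialize (H1 z w ltac:(lra) ltac:(lra)). specialize (H2 z w ltac:(lra) ltac:(lra)).
  replace (F z + G z - (F w + G w) - (D + E) * (z - w))%C
    with ((F z - F w - D * (z - w)) + (G z - G w - E * (z - w)))%C by ring.
  eapply Rle_trans; [apply Cmod_triangle|]. lra.
Qed.

Lemma strictly_diff_local_bound (F : C -> C) (z0 D : C) (d : R) (z : C) :
  (forall z w, Cmod (z - z0) < d -> Cmod (w - z0) < d ->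
      Cmod (F z - F w - D * (z - w)) <= 1 * Cmod (z - w)) ->
  Cmod (z - z0) < d ->
  Cmod (F z - F z0) <= (Cmod D + 1) * Cmod (z - z0).
Proof.
  intros H Hz.
  assert (H0 : Cmod (z0 - z0) < d).
  { replace (z0 - z0)%C with (RtoC 0) by ring. rewrite Cmod_0.
    pose proof (Cmod_ge_0 (z - z0)). lra. }
  specialize (H z z0 Hz H0).
  replace (F z - F z0)%C with (F z - F z0 - D * (z - z0) + D * (z - z0))%C by ring.
  eapply Rle_trans; [apply Cmod_triangle|]. rewrite Cmod_mult. lra.
Qed.

Lemma strictly_diff_mult (F G : C -> C) (z0 : C) :
  strictly_diff F z0 -> strictly_diff G z0 ->
  strictly_diff (fun z => F z * G z)%C z0.
Proof.
  intros (D & HD) (E & HE). exists (F z0 * E + G z0 * D)%C. intros eps Heps.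
  set (A := Cmod D + 1). set (B := Cmod E + 1).
  assert (HA : 1 <= A) by (unfold A; pose proof (Cmod_ge_0 D); lra).
  assert (HB : 1 <= B) by (unfold B; pose proof (Cmod_ge_0 E); lra).
  (* T collects the constants in front of t |z - w| at the end. *)
  set (T := Cmod (F z0) + A + (Cmod (G z0) + B) + A * B + B * A).
  pose proof (Cmod_ge_0 (F z0)) as PF. pose proof (Cmod_ge_0 (G z0)) as PG.
  assert (HAB : 0 <= A * B) by (apply Rmult_le_pos; lra).
  assert (HT : 0 < T) by (unfold T; lra).
  destruct (HD 1 Rlt_0_1) as (d1 & Hd1 & H1). destruct (HE 1 Rlt_0_1) as (e1 & He1 & K1).
  set (t := Rmin 1 (eps / T)).
  assert (Ht : 0 < t /\ t <= 1 /\ t * T <= eps).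
  { unfold t. repeat split.
    - apply Rmin_pos; [lra|]. now apply Rdiv_lt_0_compat.
    - apply Rmin_l.
    - apply Rle_trans with (eps / T * T); [|right; field; lra].
      apply Rmult_le_compat_r; [lra|apply Rmin_r]. }
  destruct (HD t ltac:(tauto)) as (d2 & Hd2 & H2).
  destruct (HE t ltac:(tauto)) as (e2 & He2 & K2).
  exists (Rmin (Rmin (Rmin d1 e1) (Rmin d2 e2)) t). split.
  { clearbody t. repeat apply Rmin_pos; tauto. }
  intros z w Hz Hw.
  assert (Hz' : Cmod (z - z0) < d1 /\ Cmod (z - z0) < e1 /\ Cmod (z - z0) < d2 /\
                Cmod (z - z0) < e2 /\ Cmod (z - z0) < t).
  { repeat split; eapply Rlt_le_trans; try exact Hz;
      eauto using Rle_trans, Rmin_l, Rmin_r. }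
  assert (Hw' : Cmod (w - z0) < d1 /\ Cmod (w - z0) < e1 /\ Cmod (w - z0) < d2 /\
                Cmod (w - z0) < e2 /\ Cmod (w - z0) < t).
  { repeat split; eapply Rlt_le_trans; try exact Hw;
      eauto using Rle_trans, Rmin_l, Rmin_r. }
  destruct Hz' as (z1 & z2 & z3 & z4 & z5). destruct Hw' as (w1 & w2 & w3 & w4 & w5).
  pose proof (strictly_diff_local_bound F z0 D d1 z H1 z1) as BF. fold A in BF.
  pose proof (strictly_diff_local_bound G z0 E e1 w K1 w2) as BG. fold B in BG.
  specialize (H2 z w z3 w3). specialize (K2 z w z4 w4).
  clear H1 K1 HD HE.
  replace (F z * G z - F w * G w - (F z0 * E + G z0 * D) * (z - w))%C
    with (F z * (G z - G w - E * (z - w)) + G w * (F z - F w - D * (z - w))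
          + ((F z - F z0) * E * (z - w) + (G w - G z0) * D * (z - w)))%C by ring.
  set (x := Cmod (z - w)) in *. assert (Hx : 0 <= x) by apply Cmod_ge_0.
  assert (BF' : Cmod (F z - F z0) <= A * t).
  { eapply Rle_trans; [exact BF|]. apply Rmult_le_compat_l; lra. }
  assert (BG' : Cmod (G w - G z0) <= B * t).
  { eapply Rle_trans; [exact BG|]. apply Rmult_le_compat_l; lra. }
  assert (CF : Cmod (F z) <= Cmod (F z0) + A).
  { replace (F z) with (F z0 + (F z - F z0))%C by ring.
    eapply Rle_trans; [apply Cmod_triangle|].
    assert (A * t <= A * 1) by (apply Rmult_le_compat_l; lra). lra. }
  assert (CG : Cmod (G w) <= Cmod (G z0) + B).
  { replace (G w) with (G z0 + (G w - G z0))%C by ring.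
    eapply Rle_trans; [apply Cmod_triangle|].
    assert (B * t <= B * 1) by (apply Rmult_le_compat_l; lra). lra. }
  eapply Rle_trans; [apply Cmod_triangle|].
  eapply Rle_trans; [apply Rplus_le_compat; apply Cmod_triangle|].
  rewrite !Cmod_mult. fold x.
  assert (S1 : Cmod (F z) * Cmod (G z - G w - E * (z - w)) <= (Cmod (F z0) + A) * (t * x)).
  { apply Rmult_le_compat; try assumption; apply Cmod_ge_0. }
  assert (S2 : Cmod (G w) * Cmod (F z - F w - D * (z - w)) <= (Cmod (G z0) + B) * (t * x)).
  { apply Rmult_le_compat; try assumption; apply Cmod_ge_0. }
  assert (S3 : Cmod (F z - F z0) * Cmod E * x <= A * t * B * x).
  { apply Rmult_le_compat_r; [assumption|].
    apply Rmult_le_compat; try apply Cmod_ge_0; [assumption|unfold B; lra]. }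
  assert (S4 : Cmod (G w - G z0) * Cmod D * x <= B * t * A * x).
  { apply Rmult_le_compat_r; [assumption|].
    apply Rmult_le_compat; try apply Cmod_ge_0; [assumption|unfold A; lra]. }
  apply Rle_trans with (t * T * x); [|apply Rmult_le_compat_r; tauto].
  unfold T. lra.
Qed.

Lemma strictly_diff_pow (F : C -> C) (z0 : C) (n : nat) :
  strictly_diff F z0 -> strictly_diff (fun z => F z ^ n)%C z0.
Proof.
  intros HF. induction n as [|n IH].
  - exact (strictly_diff_const 1 z0).
  - exact (strictly_diff_mult _ _ _ HF IH).
Qed.

Lemma strictly_diff_inv (z0 : C) : z0 <> 0 -> strictly_diff (fun z => / z)%C z0.
Proof.
  intros Hz0. exists (- / (z0 * z0))%C. intros eps Heps.
  assert (Hm : 0 < Cmod z0) by now apply Cmod_gt_0.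
  set (m := Cmod z0) in *.
  set (d := Rmin (m / 2) (eps * m ^ 3 / 12)).
  assert (Hd : 0 < d).
  { apply Rmin_pos; [lra|]. apply Rdiv_lt_0_compat; [|lra].
    apply Rmult_lt_0_compat; [lra|]. now apply pow_lt. }
  exists d. split; [exact Hd|]. intros z w Hz Hw.
  assert (d2 : d <= m / 2) by apply Rmin_l.
  assert (d3 : d <= eps * m ^ 3 / 12) by apply Rmin_r.
  assert (low : forall x, Cmod (x - z0) < d -> m / 2 <= Cmod x).
  { intros x Hx. assert (m <= Cmod x + Cmod (x - z0)).
    { unfold m. replace z0 with (x - (x - z0))%C at 1 by ring. apply Cmod_sub_le. }
    lra. }
  assert (up : Cmod w <= 2 * m).
  { replace w with (z0 + (w - z0))%C by ring.
    eapply Rle_trans; [apply Cmod_triangle|]. fold m. lra. }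
  pose proof (low z Hz) as lz. pose proof (low w Hw) as lw.
  assert (nz : z <> 0) by (apply Cmod_gt_0; lra).
  assert (nw : w <> 0) by (apply Cmod_gt_0; lra).
  replace (/ z - / w - - / (z0 * z0) * (z - w))%C
    with ((w * (z - z0) + z0 * (w - z0)) / (z0 * z0 * (z * w)) * (z - w))%C
    by (field; repeat split; assumption).
  rewrite Cmod_mult. apply Rmult_le_compat_r; [apply Cmod_ge_0|].
  rewrite Cmod_div by (repeat apply Cmult_neq_0; assumption).
  assert (Hden : m * m * (m / 2 * (m / 2)) <= Cmod (z0 * z0 * (z * w))).
  { rewrite !Cmod_mult. fold m. apply Rmult_le_compat_l; [nra|].
    apply Rmult_le_compat; lra. }
  assert (Hm4 : 0 < m * m * (m / 2 * (m / 2))).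
  { repeat apply Rmult_lt_0_compat; lra. }
  apply Rmult_le_reg_r with (Cmod (z0 * z0 * (z * w))); [lra|].
  unfold Rdiv at 1. rewrite Rmult_assoc, Rinv_l, Rmult_1_r by lra.
  apply Rle_trans with (eps * (m * m * (m / 2 * (m / 2))));
    [|apply Rmult_le_compat_l; lra].
  eapply Rle_trans; [apply Cmod_triangle|]. rewrite !Cmod_mult. fold m.
  assert (Cmod w * Cmod (z - z0) <= 2 * m * d).
  { apply Rmult_le_compat; try apply Cmod_ge_0; lra. }
  assert (m * Cmod (w - z0) <= m * d) by (apply Rmult_le_compat_l; lra).
  assert (3 * m * d <= 3 * m * (eps * m ^ 3 / 12)).
  { apply Rmult_le_compat_l; lra. }
  replace (eps * (m * m * (m / 2 * (m / 2)))) with (3 * m * (eps * m ^ 3 / 12)) by field.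
  lra.
Qed.
(** * Averages over roots of unity *)

Definition cis (t : R) : C := (cos t, sin t).

Lemma cis_plus (s t : R) : cis (s + t) = (cis s * cis t)%C.
Proof.
  unfold cis, Cmult. simpl. rewrite cos_plus, sin_plus. f_equal; ring.
Qed.

Lemma cis_0 : cis 0 = 1.
Proof. unfold cis. now rewrite cos_0, sin_0. Qed.

Lemma cis_2PI : cis (2 * PI) = 1.
Proof. unfold cis. now rewrite cos_2PI, sin_2PI. Qed.

Lemma Cmod_cis (t : R) : Cmod (cis t) = 1.
Proof.
  unfold Cmod, cis. simpl fst. simpl snd.
  replace (cos t ^ 2 + sin t ^ 2) with 1; [apply sqrt_1|].
  pose proof (sin2_cos2 t) as H. unfold Rsqr in H. lra.
Qed.

Lemma cis_neq_0 (t : R) : cis t <> 0.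
Proof. apply Cmod_gt_0. rewrite Cmod_cis. lra. Qed.

Lemma cis_pow (t : R) (m : nat) : (cis t ^ m)%C = cis (INR m * t).
Proof.
  induction m as [|m IH].
  - simpl. now rewrite Rmult_0_l, cis_0.
  - rewrite Cpow_S, IH, <- cis_plus, S_INR. f_equal. ring.
Qed.

Lemma cis_neq_1 (t : R) : 0 < t < 2 * PI -> cis t <> 1.
Proof.
  intros Ht E. assert (Hc : cos t = 1) by exact (f_equal fst E).
  assert (Hs : 0 < sin (t / 2)) by (apply sin_gt_0; lra).
  replace t with (2 * (t / 2)) in Hc by field.
  rewrite cos_2a_sin in Hc. nra.
Qed.

Lemma Rabs_sin_le (x : R) : Rabs (sin x) <= Rabs x.
Proof.
  assert (H : forall y, 0 <= y -> Rabs (sin y) <= y).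
  { intros y Hy. destruct (Rle_lt_dec 1 y) as [H1|H1].
    - pose proof (SIN_bound y). apply Rabs_le. lra.
    - destruct Hy as [Hy|<-].
      + pose proof (sin_lt_x y Hy). pose proof PI2_1.
        assert (0 <= sin y) by (apply sin_ge_0; lra).
        rewrite Rabs_pos_eq; lra.
      + rewrite sin_0, Rabs_R0. lra. }
  destruct (Rle_lt_dec 0 x) as [Hx|Hx].
  - rewrite (Rabs_pos_eq x Hx). now apply H.
  - rewrite (Rabs_left x Hx), <- Rabs_Ropp, <- sin_neg. apply H. lra.
Qed.

(** A chord is at most as long as its arc, since it equals 2 |sin((s-t)/2)|. *)
Lemma Cmod_cis_minus (s t : R) : Cmod (cis s - cis t) <= Rabs (s - t).
Proof.
  replace s with ((s - t) + t) at 1 by ring. rewrite cis_plus.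
  replace (cis (s - t) * cis t - cis t)%C with ((cis (s - t) - 1) * cis t)%C by ring.
  rewrite Cmod_mult, Cmod_cis, Rmult_1_r. set (x := s - t).
  unfold Cmod, cis. simpl fst. simpl snd.
  replace ((cos x + - (1)) ^ 2 + (sin x + - 0) ^ 2) with (Rsqr (2 * sin (x / 2))).
  - rewrite sqrt_Rsqr_abs, Rabs_mult, (Rabs_pos_eq 2) by lra.
    pose proof (Rabs_sin_le (x / 2)) as H.
    unfold Rdiv in H at 2. rewrite Rabs_mult, (Rabs_pos_eq (/ 2)) in H by lra. lra.
  - replace x with (2 * (x / 2)) at 2 3 by field.
    rewrite cos_2a_sin, sin_2a.
    pose proof (sin2_cos2 (x / 2)) as H. unfold Rsqr in *.
    transitivity (4 * sin (x / 2) * sin (x / 2) * (sin (x / 2) * sin (x / 2) + cos (x / 2) * cos (x / 2)));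
      [rewrite H|]; ring.
Qed.

(** The circle is divided into [S p] equal arcs, so that there is at least one
    node. *)
Definition angle (p : nat) : R := 2 * PI / INR (S p).

Definition node (r : R) (p j : nat) : C := (r * cis (INR j * angle p))%C.

Definition avg (K : C -> C) (r : R) (p : nat) : C :=
  (/ INR (S p) * sum_n (fun j => K (node r p j)) p)%C.

Lemma INR_S_pos (p : nat) : 0 < INR (S p).
Proof. apply lt_0_INR. lia. Qed.

Lemma angle_pos (p : nat) : 0 < angle p.
Proof.
  unfold angle. apply Rdiv_lt_0_compat; [pose proof PI_RGT_0; lra|apply INR_S_pos].
Qed.

Lemma INR_mult_angle_bound (p m : nat) :
  (m <= p)%nat -> INR m * angle p < 2 * PI.
Proof.
  intros Hm. pose proof (INR_S_pos p). pose proof PI_RGT_0.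
  apply Rmult_lt_reg_r with (INR (S p)); [assumption|].
  unfold angle. replace (INR m * (2 * PI / INR (S p)) * INR (S p)) with (2 * PI * INR m) by (field; lra).
  apply Rmult_lt_compat_l; [lra|]. apply lt_INR. lia.
Qed.

Lemma Cmod_node (r : R) (p j : nat) : 0 <= r -> Cmod (node r p j) = r.
Proof.
  intros Hr. unfold node. now rewrite Cmod_mult, Cmod_cis, Cmod_R, Rabs_pos_eq, Rmult_1_r.
Qed.

Lemma node_S (r : R) (p j : nat) : node r p (S j) = (cis (angle p) * node r p j)%C.
Proof.
  unfold node. rewrite S_INR, Rmult_plus_distr_r, Rmult_1_l, cis_plus. ring.
Qed.

Lemma node_last (r : R) (p : nat) : node r p (S p) = node r p 0.
Proof.
  unfold node, angle. replace (INR (S p) * (2 * PI / INR (S p))) with (2 * PI).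
  - simpl INR. now rewrite Rmult_0_l, cis_0, cis_2PI.
  - pose proof (INR_S_pos p). field. lra.
Qed.

Lemma avg_ext (K K' : C -> C) (r : R) (p : nat) :
  0 <= r -> (forall z, Cmod z = r -> K z = K' z) -> avg K r p = avg K' r p.
Proof.
  intros Hr H. unfold avg. f_equal. apply sum_n_ext. intros j. apply H. now apply Cmod_node.
Qed.

Lemma avg_plus (K K' : C -> C) (r : R) (p : nat) :
  avg (fun z => K z + K' z)%C r p = (avg K r p + avg K' r p)%C.
Proof. unfold avg. rewrite sum_n_Cadd. ring. Qed.

Lemma avg_scal (a : C) (K : C -> C) (r : R) (p : nat) :
  avg (fun z => a * K z)%C r p = (a * avg K r p)%C.
Proof. unfold avg. rewrite sum_n_Cmult_l. ring. Qed.

Lemma avg_const (a : C) (r : R) (p : nat) : avg (fun _ => a) r p = a.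
Proof.
  unfold avg.
  assert (H : forall n, sum_n (fun _ => a) n = (INR (S n) * a)%C :> C).
  { induction n as [|n IH].
    - rewrite sum_O. simpl. ring.
    - rewrite sum_n_Cplus, IH, (S_INR (S n)), RtoC_plus. ring. }
  rewrite H. field. intros E. apply RtoC_inj in E. pose proof (INR_S_pos p). lra.
Qed.

Lemma Cmod_avg_sum (K : C -> C) (r : R) (p : nat) :
  Cmod (avg K r p) = / INR (S p) * Cmod (sum_n (fun j => K (node r p j)) p).
Proof.
  unfold avg. pose proof (INR_S_pos p).
  rewrite Cmod_mult, <- RtoC_inv by lra. rewrite Cmod_R, Rabs_pos_eq; [reflexivity|].
  left. now apply Rinv_0_lt_compat.
Qed.

Lemma Cmod_avg_le_nodes (K : C -> C) (B r : R) (p : nat) :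
  (forall j, (j <= p)%nat -> Cmod (K (node r p j)) <= B) -> Cmod (avg K r p) <= B.
Proof.
  intros H. rewrite Cmod_avg_sum. pose proof (INR_S_pos p) as Hp.
  apply Rle_trans with (/ INR (S p) * (INR (S p) * B)).
  - apply Rmult_le_compat_l; [left; now apply Rinv_0_lt_compat|].
    now apply Cmod_sum_n_le_const.
  - right. field. lra.
Qed.

Lemma Cmod_avg_le (K : C -> C) (B r : R) (p : nat) :
  0 <= r -> (forall z, Cmod z = r -> Cmod (K z) <= B) -> Cmod (avg K r p) <= B.
Proof.
  intros Hr H. apply Cmod_avg_le_nodes. intros j _. apply H. now apply Cmod_node.
Qed.

(** Rotation by one arc permutes the nodes cyclically. *)
Lemma sum_n_rotate (K : C -> C) (r : R) (p : nat) :
  sum_n (fun j => K (cis (angle p) * node r p j)%C) p = sum_n (fun j => K (node r p j)) p :> C.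
Proof.
  assert (E : (sum_n (fun j => K (node r p (S j))) p + K (node r p 0))%C
              = (sum_n (fun j => K (node r p j)) p + K (node r p (S p)))%C).
  { rewrite <- (sum_n_Cplus (fun j => K (node r p j))), sum_n_first. apply Cplus_comm. }
  rewrite node_last in E.
  rewrite (sum_n_ext _ (fun j => K (node r p (S j)))) by (intros j; now rewrite node_S).
  assert (cancel : forall x y k : C, (x + k = y + k)%C -> x = y).
  { intros x y k Hk. replace x with (x + k - k)%C by ring. rewrite Hk. ring. }
  exact (cancel _ _ _ E).
Qed.

Lemma avg_rotate (K : C -> C) (r : R) (p : nat) :
  avg (fun z => K (cis (angle p) * z)%C) r p = avg K r p.
Proof. unfold avg. now rewrite sum_n_rotate. Qed.

(** If rotation by one arc multiplies K by k, rotation invariance of the average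
    gives k avg K = avg K. *)
Lemma avg_eigen (K : C -> C) (k : C) (r : R) (p : nat) :
  0 <= r -> (forall z, Cmod z = r -> K (cis (angle p) * z)%C = (k * K z)%C) ->
  k <> 1 -> avg K r p = 0.
Proof.
  intros Hr H Hk.
  assert (E : (k * avg K r p)%C = avg K r p).
  { rewrite <- avg_scal, <- (avg_rotate K). apply avg_ext; [exact Hr|].
    intros z Hz. symmetry. now apply H. }
  assert (Hk' : (k - 1)%C <> 0).
  { intros E'. apply Hk. replace k with ((k - 1) + 1)%C by ring. rewrite E'. ring. }
  replace (avg K r p) with (/ (k - 1) * (k * avg K r p - avg K r p))%C by (field; exact Hk').
  rewrite E. ring.
Qed.

(** The condition m <= p, i.e. m smaller than the number of nodes, excludes
    aliasing. *)
Lemma cis_angle_pow_neq_1 (p m : nat) :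
  (1 <= m <= p)%nat -> (cis (angle p) ^ m)%C <> 1.
Proof.
  intros Hm. rewrite cis_pow. apply cis_neq_1. split.
  - apply Rmult_lt_0_compat; [apply lt_0_INR; lia|apply angle_pos].
  - apply INR_mult_angle_bound. lia.
Qed.

Lemma avg_pow (r : R) (p m : nat) :
  0 <= r -> (1 <= m <= p)%nat -> avg (fun z => z ^ m)%C r p = 0.
Proof.
  intros Hr Hm. apply (avg_eigen _ (cis (angle p) ^ m)%C); [exact Hr| |].
  - intros z _. apply Cpow_mult_l.
  - now apply cis_angle_pow_neq_1.
Qed.

Lemma Cinv_mult_distr (x y : C) : x <> 0 -> y <> 0 -> (/ (x * y) = / x * / y)%C.
Proof. intros. field. now split. Qed.

Lemma Cmod_pos_neq_0 (z : C) (r : R) : 0 < r -> Cmod z = r -> z <> 0.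
Proof. intros Hr Hz. apply Cmod_gt_0. lra. Qed.

Lemma avg_inv_pow (r : R) (p m : nat) :
  0 < r -> (1 <= m <= p)%nat -> avg (fun z => (/ z) ^ m)%C r p = 0.
Proof.
  intros Hr Hm. apply (avg_eigen _ ((/ cis (angle p)) ^ m)%C); [lra| |].
  - intros z Hz. rewrite Cinv_mult_distr, Cpow_mult_l; [reflexivity|apply cis_neq_0|].
    now apply (Cmod_pos_neq_0 z r).
  - rewrite Cpow_inv by apply cis_neq_0. intros E. apply (cis_angle_pow_neq_1 p m Hm).
    assert (Hn : (cis (angle p) ^ m)%C <> 0) by apply Cpow_nz, cis_neq_0.
    replace (cis (angle p) ^ m)%C with (/ (/ (cis (angle p) ^ m)))%C by now field.
    rewrite E. now field.
Qed.
(** * Independence of the radius *)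

Lemma polar_dist (x y i j : R) :
  0 <= i -> Cmod (x * cis y - i * cis j) <= Rabs (x - i) + i * Rabs (y - j).
Proof.
  intros Hi.
  replace (x * cis y - i * cis j)%C with (RtoC (x - i) * cis y + i * (cis y - cis j))%C
    by (rewrite RtoC_minus; ring).
  eapply Rle_trans; [apply Cmod_triangle|].
  rewrite !Cmod_mult, Cmod_cis, !Cmod_R, (Rabs_pos_eq i Hi), Rmult_1_r.
  apply Rplus_le_compat_l, Rmult_le_compat_l; [exact Hi|]. apply Cmod_cis_minus.
Qed.

(** Compactness of the annulus, taken in polar coordinates so that it becomes a
    closed rectangle.  Each centre comes with its own radius of validity; a
    covering with at most half of these radii leaves room for z and w. *)
Lemma strictly_diff_uniform (K : C -> C) (r0 r1 : R) :
  0 < r0 ->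
  (forall z, r0 <= Cmod z <= r1 -> strictly_diff K z) ->
  forall eps, 0 < eps -> exists d, 0 < d /\
    forall r t, r0 <= r <= r1 -> 0 <= t <= 2 * PI -> exists D : C,
      forall z w, Cmod (z - r * cis t) < d -> Cmod (w - r * cis t) < d ->
        Cmod (K z - K w - D * (z - w)) <= eps * Cmod (z - w).
Proof.
  intros Hr0 H eps Heps.
  assert (Hex : forall i j : R, exists d : posreal, r0 <= i <= r1 -> exists D : C,
    forall z w, Cmod (z - i * cis j) < d -> Cmod (w - i * cis j) < d ->
        Cmod (K z - K w - D * (z - w)) <= eps * Cmod (z - w)).
  { intros i j. destruct (excluded_middle_informative (r0 <= i <= r1)) as [Hi|Hi].
    - destruct (H (i * cis j)%C) as [D HD].
      { rewrite Cmod_mult, Cmod_cis, Cmod_R, Rabs_pos_eq; lra. }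
      destruct (HD eps Heps) as (d & Hd & Hzw).
      exists (mkposreal d Hd). intros _. now exists D.
    - exists (mkposreal 1 Rlt_0_1). intros Hi'. contradiction. }
  destruct (Rlt_le_dec r1 r0) as [Hr|Hr].
  { exists 1. split; [lra|]. intros r t Hrr. lra. }
  pose (d0 := fun i j => proj1_sig (constructive_indefinite_description _ (Hex i j))).
  assert (Hd0 : forall i j, r0 <= i <= r1 -> exists D : C,
    forall z w, Cmod (z - i * cis j) < d0 i j -> Cmod (w - i * cis j) < d0 i j ->
        Cmod (K z - K w - D * (z - w)) <= eps * Cmod (z - w)).
  { intros i j. exact (proj2_sig (constructive_indefinite_description _ (Hex i j))). }
  assert (Hs : 0 < / (2 * (1 + r1))) by (apply Rinv_0_lt_compat; lra).
  (* Polar coordinates distort distances by at most the factor 1 + r1. *)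
  pose (delta := fun i j => mkposreal (d0 i j * / (2 * (1 + r1)))
                   (Rmult_lt_0_compat _ _ (cond_pos (d0 i j)) Hs)).
  destruct (compactness_value_2d r0 r1 0 (2 * PI) delta) as [d Hd].
  exists d. split; [apply cond_pos|]. intros r t Hrr Ht.
  destruct (excluded_middle_informative (exists u v : R, r0 <= u <= r1 /\ 0 <= v <= 2 * PI /\
     Rabs (r - u) < delta u v /\ Rabs (t - v) < delta u v /\ d <= delta u v)) as [Hc|Hc];
    [|exfalso; exact (Hd r t Hrr Ht Hc)].
  destruct Hc as (u & v & Hu & Hv & H1 & H2 & H3). simpl in H1, H2, H3.
  destruct (Hd0 u v Hu) as [D HD]. exists D.
  set (e := d0 u v * / (2 * (1 + r1))) in *.
  assert (He : (1 + r1) * e = d0 u v / 2) by (unfold e; field; lra).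
  assert (He0 : 0 <= e) by (pose proof (Rabs_pos (r - u)); lra).
  assert (Hdist : Cmod (r * cis t - u * cis v) <= d0 u v / 2).
  { eapply Rle_trans; [apply polar_dist; lra|]. rewrite <- He, Rmult_plus_distr_r, Rmult_1_l.
    apply Rplus_le_compat; [lra|]. apply Rmult_le_compat; try lra. apply Rabs_pos. }
  assert (He1 : e <= (1 + r1) * e).
  { rewrite <- (Rmult_1_l e) at 1. apply Rmult_le_compat_r; lra. }
  assert (near : forall x, Cmod (x - r * cis t) < d -> Cmod (x - u * cis v) < d0 u v).
  { intros x Hx.
    replace (x - u * cis v)%C with ((x - r * cis t) + (r * cis t - u * cis v))%C by ring.
    eapply Rle_lt_trans; [apply Cmod_triangle|]. lra. }
  intros z w Hz Hw. apply HD; now apply near.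
Qed.

(** One radial step.  With l = (q - 1)/(zeta - 1) the linear parts of
    K(q z) - K(z) and l (K(zeta z) - K(z)) coincide, whatever the derivative is,
    and the latter has average 0. *)
Lemma Cmod_avg_step (K : C -> C) (eps d r : R) (p : nat) :
  0 < r -> (1 <= p)%nat -> r * angle p < d ->
  (forall t, 0 <= t <= 2 * PI -> exists D : C,
      forall z w, Cmod (z - r * cis t) < d -> Cmod (w - r * cis t) < d ->
        Cmod (K z - K w - D * (z - w)) <= eps * Cmod (z - w)) ->
  0 <= eps ->
  Cmod (avg K (r * exp (- angle p)) p - avg K r p) <= 2 * eps * r * angle p.
Proof.
  intros Hr Hp Hd H Heps.
  set (q := exp (- angle p)). set (zeta := cis (angle p)).
  pose proof (angle_pos p) as Ha.
  assert (Hq : 1 - angle p <= q <= 1).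
  { unfold q. split; [pose proof (exp_ineq1_le (- angle p)); lra|].
    rewrite <- exp_0. left. apply exp_increasing. lra. }
  assert (Hz1 : (zeta - 1)%C <> 0).
  { intros E. apply (cis_angle_pow_neq_1 p 1); [lia|]. fold zeta.
    replace (zeta ^ 1)%C with ((zeta - 1) + 1)%C by (simpl; ring). rewrite E. ring. }
  assert (Hz2 : Cmod (zeta - 1) <= angle p).
  { unfold zeta. rewrite <- cis_0. eapply Rle_trans; [apply Cmod_cis_minus|].
    rewrite Rminus_0_r, Rabs_pos_eq; lra. }
  pose (l := ((q - 1) / (zeta - 1))%C).
  assert (E : (avg K (r * q) p - avg K r p)%C
     = avg (fun z => (K (q * z) - K z - l * (K (zeta * z) - K z)))%C r p).
  { transitivity (avg (fun z => K (q * z)%C) r p + (-1) * avg K r p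
       + (- l) * (avg (fun z => K (zeta * z)%C) r p + (-1) * avg K r p))%C.
    - unfold zeta. rewrite avg_rotate.
      replace (avg (fun z => K (q * z)%C) r p) with (avg K (r * q) p); [ring|].
      unfold avg. f_equal. apply sum_n_ext. intros j. f_equal. unfold node.
      rewrite RtoC_mult. ring.
    - rewrite <- !avg_scal, <- !avg_plus, <- avg_scal, <- avg_plus.
      apply avg_ext; [lra|]. intros z _. ring. }
  rewrite E. apply Cmod_avg_le_nodes. intros j Hj.
  destruct (H (INR j * angle p)) as [D HD].
  { split; [apply Rmult_le_pos; [apply pos_INR|lra]|]. left. now apply INR_mult_angle_bound. }
  fold (node r p j) in HD. set (z := node r p j) in *.
  assert (Hz : Cmod z = r) by (apply Cmod_node; lra).
  assert (Hq1 : Cmod (q * z - z) = r * (1 - q)).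
  { replace (q * z - z)%C with (RtoC (q - 1) * z)%C by (rewrite RtoC_minus; ring).
    rewrite Cmod_mult, Hz, Cmod_R, Rabs_minus_sym, Rabs_pos_eq by lra. ring. }
  assert (Hz3 : Cmod (zeta * z - z) = r * Cmod (zeta - 1)).
  { replace (zeta * z - z)%C with ((zeta - 1) * z)%C by ring.
    rewrite Cmod_mult, Hz. ring. }
  assert (B1 : r * (1 - q) <= r * angle p) by (apply Rmult_le_compat_l; lra).
  assert (B2 : r * Cmod (zeta - 1) <= r * angle p) by (apply Rmult_le_compat_l; lra).
  assert (Hzz : Cmod (z - z) < d).
  { replace (z - z)%C with (RtoC 0) by ring. rewrite Cmod_0.
    assert (0 < r * angle p) by now apply Rmult_lt_0_compat. lra. }
  pose proof (HD (q * z)%C z ltac:(lra) Hzz) as S1.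
  pose proof (HD (zeta * z)%C z ltac:(lra) Hzz) as S2.
  rewrite Hq1 in S1. rewrite Hz3 in S2.
  replace (K (q * z) - K z - l * (K (zeta * z) - K z))%C
    with ((K (q * z) - K z - D * (q * z - z))
          - l * (K (zeta * z) - K z - D * (zeta * z - z)))%C
    by (unfold l; field; exact Hz1).
  eapply Rle_trans; [apply Cmod_sub_le|]. rewrite Cmod_mult.
  assert (Hl : Cmod l * Cmod (zeta - 1) = 1 - q).
  { rewrite <- Cmod_mult. unfold l. replace ((q - 1) / (zeta - 1) * (zeta - 1))%C
      with (RtoC (q - 1)) by (rewrite RtoC_minus; field; exact Hz1).
    rewrite Cmod_R, Rabs_minus_sym, Rabs_pos_eq; lra. }
  assert (S3 : Cmod l * Cmod (K (zeta * z)%C - K z - D * (zeta * z - z)) <= eps * (r * (1 - q))).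
  { eapply Rle_trans; [apply Rmult_le_compat_l; [apply Cmod_ge_0|exact S2]|].
    right. rewrite <- Hl. ring. }
  assert (S4 : eps * (r * (1 - q)) <= eps * (r * angle p)) by now apply Rmult_le_compat_l.
  lra.
Qed.

Lemma exp_monotone (x y : R) : x <= y -> exp x <= exp y.
Proof. intros [H| ->]; [left; now apply exp_increasing|apply Rle_refl]. Qed.

(** The ratio exp(-2 pi L) of the radii is chosen so that L N steps of ratio
    exp(-2 pi/N) lead exactly from one circle to the other. *)
Lemma avg_radius_independent (K : C -> C) (r1 : R) (L : nat) :
  0 < r1 ->
  (forall z, 0 < Cmod z <= r1 -> strictly_diff K z) ->
  forall eps, 0 < eps -> exists N, forall p, (N <= p)%nat ->
    Cmod (avg K (r1 * exp (- (INR L * (2 * PI)))) p - avg K r1 p) <= eps.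
Proof.
  intros Hr1 H eps Heps.
  set (r0 := r1 * exp (- (INR L * (2 * PI)))).
  assert (Hr0 : 0 < r0) by (apply Rmult_lt_0_compat; [assumption|apply exp_pos]).
  pose proof PI_RGT_0 as HPI.
  assert (HL : 0 <= INR L * (2 * PI)) by (apply Rmult_le_pos; [apply pos_INR|lra]).
  set (T := INR L * (2 * PI) * (2 * r1) + 1).
  assert (HT : 0 < T).
  { unfold T. assert (0 <= INR L * (2 * PI) * (2 * r1)) by (apply Rmult_le_pos; lra). lra. }
  assert (He : 0 < eps / T) by now apply Rdiv_lt_0_compat.
  destruct (strictly_diff_uniform K r0 r1 Hr0) with (eps := eps / T) as (d & Hd & HK).
  { intros z Hz. apply H. lra. }
  { exact He. }
  assert (Hsmall : exists N, forall p, (N <= p)%nat -> r1 * angle p < d).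
  { destruct (archimed_cor1 (d / (r1 * (2 * PI)))) as (N & HN & HN0).
    { apply Rdiv_lt_0_compat; [assumption|]. apply Rmult_lt_0_compat; lra. }
    exists N. intros p Hp. pose proof (INR_S_pos p). unfold angle.
    assert (HNp : 0 < INR N) by now apply lt_0_INR.
    assert (/ INR (S p) < d / (r1 * (2 * PI))).
    { eapply Rle_lt_trans; [|exact HN]. apply Rinv_le_contravar; [assumption|].
      apply le_INR. lia. }
    assert (HP : 0 < r1 * (2 * PI)) by (apply Rmult_lt_0_compat; lra).
    replace (r1 * (2 * PI / INR (S p))) with (/ INR (S p) * (r1 * (2 * PI))) by (field; lra).
    replace d with (d / (r1 * (2 * PI)) * (r1 * (2 * PI))) by (field; lra).
    now apply Rmult_lt_compat_r. }
  destruct Hsmall as [N HN]. exists (Nat.max N 1). intros p Hp.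
  pose proof (angle_pos p) as Ha.
  assert (Hsteps : forall m, (m <= L * S p)%nat ->
    Cmod (avg K (r1 * exp (- (INR m * angle p))) p - avg K r1 p)
      <= INR m * (2 * (eps / T) * r1 * angle p)).
  { induction m as [|m IH]; intros Hm.
    - simpl INR. rewrite Rmult_0_l, Ropp_0, exp_0, Rmult_1_r.
      replace (avg K r1 p - avg K r1 p)%C with (RtoC 0) by ring. rewrite Cmod_0. lra.
    - specialize (IH ltac:(lia)).
      set (r := r1 * exp (- (INR m * angle p))) in *.
      assert (Hr : 0 < r) by (apply Rmult_lt_0_compat; [assumption|apply exp_pos]).
      assert (Hrr : r0 <= r <= r1).
      { assert (Hma : INR m * angle p <= INR L * (2 * PI)).
        { replace (INR L * (2 * PI)) with (INR (L * S p) * angle p).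
          - apply Rmult_le_compat_r; [lra|]. apply le_INR. lia.
          - rewrite mult_INR. unfold angle. pose proof (INR_S_pos p). field. lra. }
        assert (0 <= INR m * angle p) by (apply Rmult_le_pos; [apply pos_INR|lra]).
        unfold r0, r. split.
        - apply Rmult_le_compat_l; [lra|]. apply exp_monotone. lra.
        - rewrite <- (Rmult_1_r r1) at 2. apply Rmult_le_compat_l; [lra|].
          rewrite <- exp_0. apply exp_monotone. lra. }
      replace (r1 * exp (- (INR (S m) * angle p))) with (r * exp (- angle p)).
      2: { unfold r. rewrite Rmult_assoc, <- exp_plus, S_INR. do 2 f_equal. ring. }
      assert (Hra : r * angle p <= r1 * angle p) by (apply Rmult_le_compat_r; lra).
      specialize (HN p ltac:(lia)).
      pose proof (Cmod_avg_step K (eps / T) d r p Hr ltac:(lia) ltac:(lra)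
        (fun t Ht => HK r t Hrr Ht) ltac:(lra)) as S1.
      replace (avg K (r * exp (- angle p)) p - avg K r1 p)%C
        with ((avg K (r * exp (- angle p)) p - avg K r p) + (avg K r p - avg K r1 p))%C by ring.
      eapply Rle_trans; [apply Cmod_triangle|]. rewrite S_INR.
      assert (2 * (eps / T) * r * angle p <= 2 * (eps / T) * r1 * angle p).
      { rewrite !Rmult_assoc. repeat apply Rmult_le_compat_l; lra. }
      lra. }
  specialize (Hsteps (L * S p)%nat (le_n _)).
  assert (EL : INR (L * S p) * angle p = INR L * (2 * PI)).
  { rewrite mult_INR. unfold angle. pose proof (INR_S_pos p). field. lra. }
  rewrite EL in Hsteps. fold r0 in Hsteps.
  eapply Rle_trans; [exact Hsteps|].
  replace (INR (L * S p) * (2 * (eps / T) * r1 * angle p))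
    with ((eps / T) * (INR (L * S p) * angle p * (2 * r1))) by ring.
  rewrite EL. replace eps with (eps / T * T) at 2 by (field; lra).
  apply Rmult_le_compat_l; [lra|]. unfold T. lra.
Qed.
(** * Finite expansions at the origin *)

(** The origin itself is excluded: the functions of interest contain omega(z)/z. *)
Definition near0 (P : C -> Prop) : Prop :=
  exists rho, 0 < rho /\ forall z, 0 < Cmod z < rho -> P z.

Lemma near0_and (P Q : C -> Prop) :
  near0 P -> near0 Q -> near0 (fun z => P z /\ Q z).
Proof.
  intros (r & Hr & HP) (s & Hs & HQ). exists (Rmin r s).
  split; [now apply Rmin_pos|]. intros z Hz.
  pose proof (Rmin_l r s). pose proof (Rmin_r r s).
  split; [apply HP|apply HQ]; lra.
Qed.

Lemma near0_impl (P Q : C -> Prop) :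
  near0 P -> (forall z : C, z <> 0 -> P z -> Q z) -> near0 Q.
Proof.
  intros (r & Hr & HP) HPQ. exists r. split; [exact Hr|]. intros z Hz.
  apply HPQ; [apply Cmod_gt_0; lra|now apply HP].
Qed.

(** H(z) = c_0 + c_1 z + ... + c_(n-1) z^(n-1) + O(z^n) near 0.  The recursive form,
    one coefficient at a time, makes products and uniqueness easy inductions. *)
Fixpoint expands (n : nat) (c : nat -> C) (H : C -> C) : Prop :=
  match n with
  | O => exists M, near0 (fun z => Cmod (H z) <= M)
  | S n => exists G, near0 (fun z => H z = (c 0%nat + z * G z)%C) /\
                     expands n (fun k => c (S k)) G
  end.

Lemma expands_bounded (n : nat) (c : nat -> C) (H : C -> C) :
  expands n c H -> exists M, near0 (fun z => Cmod (H z) <= M).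
Proof.
  revert c H. induction n as [|n IH]; intros c H; [easy|].
  intros (G & HG & Hn). destruct (IH _ _ Hn) as [M (rho & Hrho & HM)].
  destruct HG as (sigma & Hsigma & HG).
  exists (Cmod (c 0%nat) + 1 * Rabs M), (Rmin 1 (Rmin rho sigma)).
  split; [repeat apply Rmin_pos; lra|]. intros z Hz.
  pose proof (Rmin_l 1 (Rmin rho sigma)). pose proof (Rmin_r 1 (Rmin rho sigma)).
  pose proof (Rmin_l rho sigma). pose proof (Rmin_r rho sigma).
  rewrite HG by lra. eapply Rle_trans; [apply Cmod_triangle|].
  apply Rplus_le_compat_l. rewrite Cmod_mult.
  apply Rmult_le_compat; try apply Cmod_ge_0; [lra|].
  eapply Rle_trans; [apply HM; lra|apply Rle_abs].
Qed.

Lemma expands_pred (n : nat) (c : nat -> C) (H : C -> C) :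
  expands (S n) c H -> expands n c H.
Proof.
  revert c H. induction n as [|n IH]; intros c H HS.
  - exact (expands_bounded 1 c H HS).
  - destruct HS as (G & HG & Hn). exists G. split; [exact HG|]. now apply IH.
Qed.

Lemma expands_le (m n : nat) (c : nat -> C) (H : C -> C) :
  (m <= n)%nat -> expands n c H -> expands m c H.
Proof.
  intros Hmn. induction Hmn as [|n _ IH]; [easy|].
  intros Hn. now apply IH, expands_pred.
Qed.

Lemma expands_ext (n : nat) (c : nat -> C) (H H' : C -> C) :
  near0 (fun z => H z = H' z) -> expands n c H -> expands n c H'.
Proof.
  intros HE. destruct n as [|n].
  - intros [M HM]. exists M. apply (near0_impl _ _ (near0_and _ _ HE HM)).
    intros z _ [<- ?]. assumption.
  - intros (G & HG & Hn). exists G. split; [|exact Hn].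
    apply (near0_impl _ _ (near0_and _ _ HE HG)). intros z _ [<- ?]. assumption.
Qed.

Lemma expands_lin (n : nat) (k : C) (a b : nat -> C) (F G : C -> C) :
  expands n a F -> expands n b G ->
  expands n (fun j => k * a j + b j)%C (fun z => k * F z + G z)%C.
Proof.
  revert a b F G. induction n as [|n IH]; intros a b F G.
  - intros [M HM] [N HN]. exists (Cmod k * M + N).
    apply (near0_impl _ _ (near0_and _ _ HM HN)). intros z _ [H1 H2].
    eapply Rle_trans; [apply Cmod_triangle|]. rewrite Cmod_mult.
    apply Rplus_le_compat; [|assumption].
    apply Rmult_le_compat_l; [apply Cmod_ge_0|assumption].
  - intros (F1 & HF & HF1) (G1 & HG & HG1).
    exists (fun z => k * F1 z + G1 z)%C. split; [|exact (IH _ _ _ _ HF1 HG1)].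
    apply (near0_impl _ _ (near0_and _ _ HF HG)). intros z _ [-> ->]. ring.
Qed.

(** If F = a_0 + z F_1 and G = b_0 + z G_1, then
    F G = a_0 b_0 + z (a_0 G_1 + F_1 G), and the bracket is a case of order n. *)
Lemma expands_mult (n : nat) (a b : nat -> C) (F G : C -> C) :
  expands n a F -> expands n b G ->
  exists c, expands n c (fun z => F z * G z)%C.
Proof.
  revert a b F G. induction n as [|n IH]; intros a b F G HF HG.
  - exists a. destruct HF as [M HM], HG as [N HN]. exists (M * N).
    apply (near0_impl _ _ (near0_and _ _ HM HN)). intros z _ [H1 H2].
    rewrite Cmod_mult. apply Rmult_le_compat; try apply Cmod_ge_0; assumption.
  - pose proof (expands_pred _ _ _ HG) as HGn.
    destruct HF as (F1 & HF & HF1), HG as (G1 & HG & HG1).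
    destruct (IH _ _ _ _ HF1 HGn) as [c Hc].
    exists (fun j => match j with
                     | O => a 0%nat * b 0%nat
                     | S j => a 0%nat * b (S j) + c j
                     end)%C.
    exists (fun z => a 0%nat * G1 z + F1 z * G z)%C.
    split; [|exact (expands_lin _ _ _ _ _ _ HG1 Hc)].
    apply (near0_impl _ _ (near0_and _ _ HF HG)). intros z _ [E1 E2].
    rewrite E1, E2. ring.
Qed.

Lemma expands_pow (n k : nat) (a : nat -> C) (F : C -> C) :
  expands n a F -> exists c, expands n c (fun z => F z ^ k)%C.
Proof.
  intros HF. induction k as [|k [c Hc]].
  - exists (fun j => match j with O => 1 | S _ => 0 end)%C.
    assert (H0 : forall m, expands m (fun _ => RtoC 0) (fun _ => RtoC 0)).
    { induction m as [|m IH].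
      - exists 0, 1. split; [lra|]. intros z _. rewrite Cmod_0. lra.
      - exists (fun _ => RtoC 0). split; [|exact IH].
        exists 1. split; [lra|]. intros z _. ring. }
    destruct n as [|n].
    + exists 1, 1. split; [lra|]. intros z _. simpl. rewrite Cmod_1. lra.
    + exists (fun _ => RtoC 0). split; [|exact (H0 n)].
      exists 1. split; [lra|]. intros z _. simpl. ring.
  - exact (expands_mult _ _ _ _ _ HF Hc).
Qed.

Lemma expands_pseries (n : nat) (c : nat -> C) (F : C -> C) (rho : R) :
  0 < rho -> (forall z, Cmod z < rho -> C_pseries_sum c z (F z)) -> expands n c F.
Proof.
  intros Hrho. revert c F. induction n as [|n IH]; intros c F H.
  - destruct (C_pseries_bounded c F rho Hrho H) as [M HM].
    exists M, (rho / 4). split; [lra|]. intros z Hz. apply HM. lra.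
  - destruct (C_pseries_tail_fun (fun z => Cmod z < rho) c F H) as [F1 H1].
    exists F1. split.
    + exists rho. split; [exact Hrho|]. intros z Hz. apply H1. lra.
    + apply IH. intros z Hz. now apply H1.
Qed.

Lemma near0_point (r : R) (P : C -> Prop) :
  0 < r -> near0 P -> exists z, 0 < Cmod z <= r /\ P z.
Proof.
  intros Hr (rho & Hrho & HP).
  assert (Hm : 0 < Rmin r (rho / 2)) by (apply Rmin_pos; lra).
  pose proof (Rmin_l r (rho / 2)). pose proof (Rmin_r r (rho / 2)).
  exists (RtoC (Rmin r (rho / 2))).
  rewrite Cmod_R, Rabs_pos_eq by lra. split; [lra|].
  apply HP. rewrite Cmod_R, Rabs_pos_eq by lra. lra.
Qed.

Lemma expands_unique (a b : C) (F G : C -> C) :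
  (exists M, near0 (fun z => Cmod (F z) <= M)) ->
  (exists M, near0 (fun z => Cmod (G z) <= M)) ->
  near0 (fun z => a + z * F z = b + z * G z)%C -> a = b.
Proof.
  intros [M HM] [N HN] HE.
  assert (E : (a - b)%C = 0).
  { apply Cmod_eq_0_of_small. intros eps Heps.
    set (T := Rabs M + Rabs N + 1).
    assert (HT : 0 < T) by (pose proof (Rabs_pos M); pose proof (Rabs_pos N); unfold T; lra).
    destruct (near0_point (eps / T) _ ltac:(now apply Rdiv_lt_0_compat)
       (near0_and _ _ HE (near0_and _ _ HM HN))) as (z & Hz & E & H1 & H2).
    replace (a - b)%C with (z * (G z - F z))%C.
    - rewrite Cmod_mult. apply Rle_trans with (eps / T * T); [|right; field; lra].
      apply Rmult_le_compat; try apply Cmod_ge_0; [lra|].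
      eapply Rle_trans; [apply Cmod_sub_le|].
      pose proof (Rle_abs M). pose proof (Rle_abs N). unfold T. lra.
    - replace a with (a + z * F z - z * F z)%C by ring. rewrite E. ring. }
  replace a with ((a - b) + b)%C by ring. rewrite E. ring.
Qed.

(** H(z)/z^n is c_0/z^n + ... + c_n + O(z); the average kills the polar terms, as
    n is smaller than the number of nodes. *)
Lemma avg_extracts_coef (n : nat) (c : nat -> C) (H : C -> C) :
  expands (S n) c H ->
  exists rho M, 0 < rho /\ forall r p, 0 < r < rho -> (n <= p)%nat ->
    Cmod (avg (fun z => H z * (/ z) ^ n)%C r p - c n) <= M * r.
Proof.
  revert c H. induction n as [|n IH]; intros c H (G & HG & Hn).
  - destruct Hn as [M HM]. destruct (near0_and _ _ HG HM) as (rho & Hrho & HGM).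
    exists rho, M. split; [exact Hrho|]. intros r p Hr _.
    assert (E : (avg (fun z => H z * (/ z) ^ 0) r p - c 0%nat)%C
                = avg (fun z => z * G z)%C r p).
    { transitivity (avg (fun z => z * G z) r p + (c 0%nat - c 0%nat))%C; [|ring].
      rewrite <- (avg_const (c 0%nat) r p) at 2.
      transitivity ((avg (fun z => z * G z) r p + avg (fun _ => c 0%nat) r p) - c 0%nat)%C; [|ring].
      rewrite <- avg_plus. f_equal. apply avg_ext; [lra|]. intros z Hz.
      destruct (HGM z ltac:(lra)) as [-> _]. simpl. ring. }
    rewrite E. apply Cmod_avg_le; [lra|]. intros z Hz.
    rewrite Cmod_mult, Hz, Rmult_comm. apply Rmult_le_compat_r; [lra|].
    apply HGM. lra.
  - destruct (IH _ _ Hn) as (rho & M & Hrho & HM).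
    destruct HG as (sigma & Hsigma & HG).
    exists (Rmin rho sigma), M. split; [now apply Rmin_pos|]. intros r p Hr Hp.
    pose proof (Rmin_l rho sigma). pose proof (Rmin_r rho sigma).
    replace (avg (fun z => H z * (/ z) ^ S n)%C r p) with (avg (fun z => G z * (/ z) ^ n)%C r p).
    + apply HM; [lra|lia].
    + transitivity (c 0%nat * avg (fun z => (/ z) ^ S n)%C r p
                    + avg (fun z => G z * (/ z) ^ n)%C r p)%C.
      * rewrite avg_inv_pow by (try lra; lia). ring.
      * rewrite <- avg_scal, <- avg_plus. apply avg_ext; [lra|]. intros z Hz.
        rewrite (HG z) by lra. rewrite Cpow_S.
        assert (z <> 0) by (apply Cmod_gt_0; lra). field. assumption.
Qed.
(** * A coefficient inequality for bounded functions *)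

Lemma Cmod_avg_le_avg (K : C -> C) (w : C -> R) (S r : R) (p : nat) :
  0 <= r -> (forall z, Cmod z = r -> Cmod (K z) <= w z) ->
  avg (fun z => RtoC (w z)) r p = RtoC S -> Cmod (avg K r p) <= S.
Proof.
  intros Hr H HS. rewrite Cmod_avg_sum. pose proof (INR_S_pos p) as Hp.
  assert (E : forall n, sum_n (fun j => RtoC (w (node r p j))) n
                        = RtoC (sum_n (fun j => w (node r p j)) n) :> C).
  { induction n as [|n IH]; [now rewrite !sum_O|].
    now rewrite sum_n_Cplus, sum_n_Rplus, IH, RtoC_plus. }
  unfold avg in HS. rewrite E, <- RtoC_inv, <- RtoC_mult in HS by lra.
  apply RtoC_inj in HS. rewrite <- HS.
  apply Rmult_le_compat_l; [left; now apply Rinv_0_lt_compat|].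
  apply Cmod_sum_n_le. intros j _. apply H. now apply Cmod_node.
Qed.

Lemma Cconj_unimodular (u : C) : Cmod u = 1 -> Cconj u = (/ u)%C.
Proof.
  intros Hu. assert (Hn : u <> 0) by (apply Cmod_gt_0; lra).
  pose proof (Cmod2_conj u) as H. rewrite Hu in H.
  replace (Cconj u) with (/ u * (u * Cconj u))%C by now field.
  rewrite <- H. replace (1 ^ 2) with 1 by ring. ring.
Qed.

(** On the circle |z| = r the factor of H is |1 + mu|^2 >= 0 with
    mu = conj(l) (z/r)^n, and its average is 2 because z^n and z^(-n) have average
    0.  Written without conjugation of z it is analytic off the origin, which
    allows a change of radius. *)
Lemma Fejer_average_bound (H : C -> C) (B r : R) (l : C) (n p : nat) :
  0 < r -> (1 <= n <= p)%nat -> Cmod l = 1 ->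
  (forall z, Cmod z = r -> Cmod (H z) <= B) ->
  Cmod (avg (fun z => H z * (2 + (l * (r * / z) ^ n + Cconj l * (/ r * z) ^ n)))%C r p)
    <= 2 * B.
Proof.
  intros Hr Hn Hl HB.
  assert (Hrn : RtoC r <> 0) by (intros E; apply RtoC_inj in E; lra).
  pose (mu := fun z => (Cconj l * (/ r * z) ^ n)%C).
  assert (Hw : forall z, Cmod z = r ->
    (2 + (l * (r * / z) ^ n + Cconj l * (/ r * z) ^ n))%C = RtoC (Cmod (1 + mu z) ^ 2)).
  { intros z Hz. assert (Hzn : z <> 0) by (apply Cmod_gt_0; lra).
    assert (Hu : Cmod (/ r * z) = 1).
    { rewrite Cmod_mult, Hz, <- RtoC_inv, Cmod_R, Rabs_pos_eq by
        (try lra; left; now apply Rinv_0_lt_compat). field. lra. }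
    assert (Hmu : Cmod (mu z) = 1).
    { unfold mu. now rewrite Cmod_mult, Cmod_pow, Hu, Cmod_conj, Hl, pow1, Rmult_1_l. }
    assert (Hc : Cconj (mu z) = (l * (r * / z) ^ n)%C).
    { unfold mu. rewrite Cmult_conj, Cconj_conj, Cpow_conj, (Cconj_unimodular _ Hu).
      do 2 f_equal. field. now split. }
    rewrite Cmod2_conj, Cplus_conj, Hc.
    replace (Cconj 1) with (RtoC 1) by (unfold Cconj, RtoC; simpl; f_equal; ring).
    rewrite <- Hc. fold (mu z).
    replace ((1 + mu z) * (1 + Cconj (mu z)))%C
      with (1 + mu z * Cconj (mu z) + (Cconj (mu z) + mu z))%C by ring.
    rewrite <- Cmod2_conj, Hmu. replace (1 ^ 2) with 1 by ring.
    replace (RtoC 2) with (RtoC 1 + RtoC 1)%C by (rewrite <- RtoC_plus; f_equal; ring).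
    reflexivity. }
  apply (Cmod_avg_le_avg _ (fun z => B * Cmod (1 + mu z) ^ 2)); [lra| |].
  - intros z Hz. rewrite Cmod_mult, (Hw z Hz), Cmod_R, Rabs_pos_eq by apply pow2_ge_0.
    apply Rmult_le_compat_r; [apply pow2_ge_0|now apply HB].
  - transitivity (B * (2 + (l * r ^ n * avg (fun z => (/ z) ^ n)%C r p
                            + Cconj l * (/ r) ^ n * avg (fun z => z ^ n)%C r p)))%C.
    + rewrite <- (avg_const (RtoC 2) r p) at 1.
      rewrite <- !avg_scal, <- !avg_plus, <- avg_scal. apply avg_ext; [lra|].
      intros z Hz. rewrite RtoC_mult, <- (Hw z Hz), !Cpow_mult_l. ring.
    + rewrite avg_inv_pow, avg_pow by (try lra; lia). rewrite RtoC_mult. ring.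
Qed.

Lemma exists_small_radius (eta : R) :
  0 < eta -> exists L : nat, exp (- (INR L * (2 * PI))) < eta.
Proof.
  intros Heta. destruct (archimed_cor1 eta Heta) as (L & HL & HL0). exists L.
  assert (H0 : 0 < INR L) by now apply lt_0_INR.
  apply Rlt_trans with (/ INR L); [|exact HL].
  rewrite exp_Ropp. apply Rinv_lt_contravar.
  - apply Rmult_lt_0_compat; [exact H0|apply exp_pos].
  - pose proof (exp_ineq1_le (INR L * (2 * PI))). pose proof PI2_1.
    assert (INR L * 1 <= INR L * (2 * PI)) by (apply Rmult_le_compat_l; lra). lra.
Qed.

(** Let K be H times the Fejer weight of the circle |z| = r1.  Its average over that
    circle is at most 2B in modulus; over a small circle it is close to
    2 c_0 + l r1^n c_n.  The two averages agree up to an error that vanishes as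
    the number of nodes grows. *)
Lemma coef_bound_on_circle (H : C -> C) (c : nat -> C) (B r1 : R) (l : C) (n : nat) :
  0 < r1 -> (1 <= n)%nat -> Cmod l = 1 ->
  (forall z, 0 < Cmod z <= r1 -> strictly_diff H z) ->
  (forall z, Cmod z = r1 -> Cmod (H z) <= B) ->
  expands (S n) c H ->
  Cmod (2 * c 0%nat + l * r1 ^ n * c n) <= 2 * B.
Proof.
  intros Hr1 Hn Hl HH HB Hc.
  assert (Hrn : RtoC r1 <> 0) by (intros E; apply RtoC_inj in E; lra).
  set (K := fun z => (H z * (2 + (l * (r1 * / z) ^ n + Cconj l * (/ r1 * z) ^ n)))%C).
  assert (HK : forall z, 0 < Cmod z <= r1 -> strictly_diff K z).
  { intros z Hz. apply strictly_diff_mult; [now apply HH|].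
    assert (z <> 0) by (apply Cmod_gt_0; lra).
    apply strictly_diff_plus; [apply strictly_diff_const|].
    apply strictly_diff_plus.
    - apply strictly_diff_mult; [apply strictly_diff_const|].
      apply strictly_diff_pow, strictly_diff_mult; [apply strictly_diff_const|].
      now apply strictly_diff_inv.
    - apply strictly_diff_mult; [apply strictly_diff_const|].
      apply strictly_diff_pow, strictly_diff_mult; [apply strictly_diff_const|].
      apply strictly_diff_id. }
  destruct (avg_extracts_coef n c H Hc) as (rho1 & M1 & Hrho1 & HM1).
  destruct (avg_extracts_coef 0 c H (expands_le 1 (S n) c H ltac:(lia) Hc))
    as (rho2 & M2 & Hrho2 & HM2).
  destruct (expands_bounded _ _ _ Hc) as (M3 & rho3 & Hrho3 & HM3).
  set (T := 2 * Rabs M2 + r1 ^ n * Rabs M1 + (/ r1) ^ n * Rabs M3 + 1).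
  assert (Hr1n : 0 < r1 ^ n) by now apply pow_lt.
  assert (Hir1 : 0 < / r1) by now apply Rinv_0_lt_compat.
  assert (Hir1n : 0 < (/ r1) ^ n) by now apply pow_lt.
  assert (HT : 0 < T).
  { unfold T. pose proof (Rabs_pos M2).
    pose proof (Rmult_le_pos _ _ (Rlt_le _ _ Hr1n) (Rabs_pos M1)).
    pose proof (Rmult_le_pos _ _ (Rlt_le _ _ Hir1n) (Rabs_pos M3)). lra. }
  assert (Hsmall : forall r p, 0 < r < Rmin (Rmin rho1 rho2) (Rmin rho3 1) -> (n <= p)%nat ->
    Cmod (avg K r p - (2 * c 0%nat + l * r1 ^ n * c n)) <= T * r).
  { intros r p Hr Hp.
    assert (Hrr : r < rho1 /\ r < rho2 /\ r < rho3 /\ r < 1).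
    { repeat split; eapply Rlt_le_trans; try apply Hr;
        eauto using Rle_trans, Rmin_l, Rmin_r. }
    specialize (HM1 r p ltac:(lra) Hp). specialize (HM2 r p ltac:(lra) ltac:(lia)).
    assert (H3 : Cmod (avg (fun z => H z * z ^ n)%C r p) <= Rabs M3 * r).
    { apply Cmod_avg_le; [lra|]. intros z Hz. rewrite Cmod_mult, Cmod_pow, Hz.
      apply Rmult_le_compat; [apply Cmod_ge_0|apply pow_le; lra| |].
      - eapply Rle_trans; [apply HM3; lra|apply Rle_abs].
      - destruct n as [|n']; [lia|]. simpl. rewrite <- (Rmult_1_r r) at 3.
        apply Rmult_le_compat_l; [lra|]. rewrite <- (pow1 n'). apply pow_incr. lra. }
    assert (E : (avg K r p - (2 * c 0%nat + l * r1 ^ n * c n))%C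
       = (2 * (avg (fun z => H z * (/ z) ^ 0)%C r p - c 0%nat)
          + (l * r1 ^ n * (avg (fun z => H z * (/ z) ^ n)%C r p - c n)
             + Cconj l * (/ r1) ^ n * avg (fun z => H z * z ^ n)%C r p))%C).
    { transitivity ((2 * avg (fun z => H z * (/ z) ^ 0)%C r p
          + (l * r1 ^ n * avg (fun z => H z * (/ z) ^ n)%C r p
             + Cconj l * (/ r1) ^ n * avg (fun z => H z * z ^ n)%C r p))
          - (2 * c 0%nat + l * r1 ^ n * c n))%C; [|ring].
      rewrite <- !avg_scal, <- !avg_plus. f_equal. apply avg_ext; [lra|].
      intros z Hz. unfold K. rewrite !Cpow_mult_l. simpl. ring. }
    rewrite E.
    eapply Rle_trans; [apply Cmod_triangle|].
    eapply Rle_trans; [apply Rplus_le_compat_l, Cmod_triangle|].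
    rewrite !Cmod_mult, !Cmod_pow, Cmod_conj, Hl, Cmod_inv, !Cmod_R, (Rabs_pos_eq 2),
      (Rabs_pos_eq r1), !Rmult_1_l by (try lra; assumption).
    assert (HM1' : r1 ^ n * Cmod (avg (fun z => H z * (/ z) ^ n)%C r p - c n) <= r1 ^ n * (Rabs M1 * r)).
    { apply Rmult_le_compat_l; [lra|]. eapply Rle_trans; [exact HM1|].
      apply Rmult_le_compat_r; [lra|apply Rle_abs]. }
    assert (HM2' : Cmod (avg (fun z => H z * (/ z) ^ 0)%C r p - c 0%nat) <= Rabs M2 * r).
    { eapply Rle_trans; [exact HM2|]. apply Rmult_le_compat_r; [lra|apply Rle_abs]. }
    assert (HM3' : (/ r1) ^ n * Cmod (avg (fun z => H z * z ^ n)%C r p) <= (/ r1) ^ n * (Rabs M3 * r)).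
    { apply Rmult_le_compat_l; lra. }
    unfold T. lra. }
  apply le_epsilon. intros eps Heps.
  set (rho := Rmin (Rmin (Rmin rho1 rho2) (Rmin rho3 1)) (eps / 2 / T)).
  assert (Hrho : 0 < rho).
  { repeat apply Rmin_pos; try lra. repeat apply Rdiv_lt_0_compat; lra. }
  destruct (exists_small_radius (rho / r1) ltac:(now apply Rdiv_lt_0_compat)) as [L HL].
  destruct (avg_radius_independent K r1 L Hr1 HK (eps / 2) ltac:(lra)) as [N HN].
  set (r0 := r1 * exp (- (INR L * (2 * PI)))) in *.
  assert (Hr0 : 0 < r0 < rho).
  { split; [apply Rmult_lt_0_compat; [assumption|apply exp_pos]|].
    unfold r0. replace rho with (r1 * (rho / r1)) by (field; lra).
    now apply Rmult_lt_compat_l. }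
  set (p := Nat.max N n).
  specialize (HN p ltac:(unfold p; lia)).
  pose proof (Hsmall r0 p ltac:(split; [lra|eapply Rlt_le_trans; [apply Hr0|apply Rmin_l]])
    ltac:(unfold p; lia)) as H1.
  assert (H2 : T * r0 <= eps / 2).
  { apply Rle_trans with (T * (eps / 2 / T)); [|right; field; lra].
    apply Rmult_le_compat_l; [lra|]. left. eapply Rlt_le_trans; [apply Hr0|apply Rmin_r]. }
  pose proof (Fejer_average_bound H B r1 l n p Hr1 ltac:(unfold p; lia) Hl HB) as H3.
  fold K in H3.
  set (t := (2 * c 0%nat + l * r1 ^ n * c n)%C) in *.
  replace t with (avg K r1 p + (avg K r0 p - avg K r1 p) - (avg K r0 p - t))%C by ring.
  eapply Rle_trans; [apply Cmod_sub_le|].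
  eapply Rle_trans; [apply Rplus_le_compat_r, Cmod_triangle|]. lra.
Qed.

Lemma polar_form (c : C) : exists u, Cmod u = 1 /\ c = (Cmod c * u)%C.
Proof.
  destruct (excluded_middle_informative (c = 0)) as [->|Hc].
  - exists (RtoC 1). split; [apply Cmod_1|]. rewrite Cmod_0. ring.
  - assert (Hm : 0 < Cmod c) by now apply Cmod_gt_0.
    assert (Hn : RtoC (Cmod c) <> 0) by (intros E; apply RtoC_inj in E; lra).
    exists (c / Cmod c)%C. split.
    + rewrite Cmod_div, Cmod_R, Rabs_pos_eq by (assumption || lra). field. lra.
    + now field.
Qed.

Lemma Bernoulli_minus (t : R) (N : nat) : 0 <= t <= 1 -> 1 - INR N * t <= (1 - t) ^ N.
Proof.
  intros Ht. induction N as [|N IH]; [simpl; lra|].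
  rewrite S_INR. simpl.
  assert (0 <= INR N * t * t).
  { repeat apply Rmult_le_pos; try lra. apply pos_INR. }
  apply Rle_trans with ((1 - t) * (1 - INR N * t)); [lra|].
  apply Rmult_le_compat_l; lra.
Qed.

(** The unimodular l in [coef_bound_on_circle] is chosen to align c_n with c_0.
    With B = r^(-k) this gives r^(k+n) (2|c_0| + |c_n|) <= 2, and r tends to 1. *)
Lemma coef_bound (H : C -> C) (c : nat -> C) (k n : nat) :
  (1 <= n)%nat ->
  (forall z, 0 < Cmod z < 1 -> strictly_diff H z) ->
  (forall z, 0 < Cmod z < 1 -> Cmod (H z) * Cmod z ^ k <= 1) ->
  expands (S n) c H ->
  2 * Cmod (c 0%nat) + Cmod (c n) <= 2.
Proof.
  intros Hn HH HB Hc.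
  destruct (polar_form (c 0%nat)) as (u & Hu & Eu).
  destruct (polar_form (c n)) as (v & Hv & Ev).
  set (a := Cmod (c 0%nat)) in *. set (b := Cmod (c n)) in *.
  assert (Ha : 0 <= a) by apply Cmod_ge_0. assert (Hb : 0 <= b) by apply Cmod_ge_0.
  assert (Hr : forall r, 0 < r < 1 -> r ^ (k + n) * (2 * a + b) <= 2).
  { intros r Hr0.
    assert (Hrk : 0 < r ^ k) by (apply pow_lt; lra).
    assert (Hrn : 0 < r ^ n) by (apply pow_lt; lra).
    assert (Hl : Cmod (u * / v) = 1).
    { rewrite Cmod_mult, Cmod_inv, Hu, Hv by (apply Cmod_gt_0; lra). field. }
    (* u and v are the phases of c_0 and c_n, so u/v rotates c_n onto c_0. *)
    pose proof (coef_bound_on_circle H c (/ r ^ k) r (u * / v)%C n ltac:(lra) Hn Hl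
      ltac:(intros z Hz; apply HH; lra)) as H1.
    specialize (H1 ltac:(intros z Hz; apply Rmult_le_reg_r with (r ^ k); [lra|];
      rewrite Rinv_l by lra; rewrite <- Hz; apply HB; lra) Hc).
    assert (E : (2 * c 0%nat + u * / v * r ^ n * c n)%C = (RtoC (2 * a + r ^ n * b) * u)%C).
    { rewrite Eu, Ev at 1. rewrite RtoC_plus, !RtoC_mult, RtoC_pow. field.
      apply Cmod_gt_0. lra. }
    rewrite E, Cmod_mult, Hu, Cmod_R, Rabs_pos_eq, Rmult_1_r in H1
      by (apply Rplus_le_le_0_compat; [lra|]; apply Rmult_le_pos; lra).
    apply (Rmult_le_compat_l (r ^ k)) in H1; [|lra].
    replace (r ^ k * (2 * / r ^ k)) with 2 in H1 by (field; lra).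
    eapply Rle_trans; [|exact H1]. rewrite pow_add, Rmult_assoc.
    apply Rmult_le_compat_l; [lra|].
    assert (r ^ n * (2 * a) <= 1 * (2 * a)).
    { apply Rmult_le_compat_r; [lra|]. rewrite <- (pow1 n). apply pow_incr. lra. }
    lra. }
  apply le_epsilon. intros eps Heps.
  set (q := INR (k + n) * (2 * a + b) + 1).
  assert (Hq : 1 <= q).
  { unfold q. assert (0 <= INR (k + n) * (2 * a + b)) by
      (apply Rmult_le_pos; [apply pos_INR|lra]). lra. }
  set (t := Rmin (/ 2) (eps / q)).
  assert (Ht : 0 < t <= / 2).
  { split; [|apply Rmin_l]. apply Rmin_pos; [lra|]. apply Rdiv_lt_0_compat; lra. }
  assert (Htq : t * q <= eps).
  { apply Rle_trans with (eps / q * q); [|right; field; lra].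
    apply Rmult_le_compat_r; [lra|apply Rmin_r]. }
  specialize (Hr (1 - t) ltac:(lra)).
  pose proof (Bernoulli_minus t (k + n) ltac:(lra)) as HBe.
  apply (Rmult_le_compat_r (2 * a + b)) in HBe; [|lra].
  assert (t * q = INR (k + n) * t * (2 * a + b) + t) by (unfold q; ring).
  lra.
Qed.
(** * Comparison of the coefficients *)

(** The functions H_k, considered on punctured neighbourhoods of the origin. *)
Definition twisted (W omega : C -> C) (k : nat) (z : C) : C :=
  (W z * (omega z * / z) ^ k)%C.

Lemma expands_analytic (n : nat) (F : C -> C) :
  analytic_at F 0 -> exists c, expands n c F /\ c 0%nat = F 0.
Proof.
  intros (c & rho & Hrho & H).
  assert (H' : forall z, Cmod z < rho -> C_pseries_sum c z (F z)).
  { intros z Hz. specialize (H z). replace (z - 0)%C with z in H by ring. now apply H. }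
  exists c. split; [now apply (expands_pseries n c F rho)|].
  symmetry. apply C_pseries_at_0, H'. rewrite Cmod_0. exact Hrho.
Qed.

Lemma unit_disk_0 : unit_disk 0.
Proof. unfold unit_disk. rewrite Cmod_0. lra. Qed.

Lemma expands_omega_quotient (n : nat) (omega : C -> C) :
  analytic_at omega 0 -> omega 0 = 0 ->
  exists c, expands n c (fun z => omega z * / z)%C.
Proof.
  intros Ho H0. destruct (expands_analytic (S n) omega Ho) as (c & (G & HG & Hn) & Hc).
  exists (fun k => c (S k)). apply (expands_ext n _ G); [|exact Hn].
  apply (near0_impl _ _ HG). intros z Hz ->. rewrite Hc, H0. field. exact Hz.
Qed.

Lemma expands_twisted (n : nat) (W omega : C -> C) (k : nat) :
  analytic_at W 0 -> analytic_at omega 0 -> omega 0 = 0 ->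
  exists c, expands n c (twisted W omega k).
Proof.
  intros HW Ho H0.
  destruct (expands_analytic n W HW) as (a & Ha & _).
  destruct (expands_omega_quotient n omega Ho H0) as (b & Hb).
  destruct (expands_pow n k b _ Hb) as (b' & Hb').
  exact (expands_mult n a b' _ _ Ha Hb').
Qed.

(** As |W| <= 1 and |omega| <= 1, only |H_k(z)| <= |z|^(-k) is known here, which is
    the hypothesis of [coef_bound]. *)
Lemma twisted_coef_bound (W omega : C -> C) (c : nat -> C) (k n : nat) :
  class_B W -> class_B omega -> (1 <= n)%nat ->
  expands (S n) c (twisted W omega k) ->
  2 * Cmod (c 0%nat) + Cmod (c n) <= 2.
Proof.
  intros [HW BW] [Ho Bo] Hn. apply (coef_bound _ c k n Hn).
  - intros z Hz. assert (z <> 0) by (apply Cmod_gt_0; lra).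
    apply strictly_diff_mult; [apply analytic_strictly_diff, HW; unfold unit_disk; lra|].
    apply strictly_diff_pow, strictly_diff_mult.
    + apply analytic_strictly_diff, Ho. unfold unit_disk. lra.
    + now apply strictly_diff_inv.
  - intros z Hz. assert (Hn0 : z <> 0) by (apply Cmod_gt_0; lra).
    rewrite <- Cmod_pow, <- Cmod_mult. unfold twisted.
    replace (W z * (omega z * / z) ^ k * z ^ k)%C with (W z * omega z ^ k)%C.
    + rewrite Cmod_mult, Cmod_pow, <- (Rmult_1_l 1).
      apply Rmult_le_compat; [apply Cmod_ge_0|apply pow_le, Cmod_ge_0| |].
      * apply BW. unfold unit_disk. lra.
      * rewrite <- (pow1 k). apply pow_incr. split; [apply Cmod_ge_0|].
        apply Bo. unfold unit_disk. lra.
    + rewrite <- Cmult_assoc, <- Cpow_mult_l. do 2 f_equal. now field.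
Qed.

Lemma omega_small (omega : C -> C) (eps : R) :
  analytic_at omega 0 -> omega 0 = 0 -> 0 < eps ->
  near0 (fun z => Cmod (omega z) < eps).
Proof.
  intros Ho H0 Heps. destruct (expands_omega_quotient 0 omega Ho H0) as (_ & M & rho & Hrho & HM).
  assert (HM1 : 0 < Rabs M + 1) by (pose proof (Rabs_pos M); lra).
  exists (Rmin rho (eps / (Rabs M + 1))).
  split; [apply Rmin_pos; [assumption|now apply Rdiv_lt_0_compat]|]. intros z Hz.
  assert (Hz1 : Cmod z < rho) by (eapply Rlt_le_trans; [apply Hz|apply Rmin_l]).
  assert (Hz2 : Cmod z < eps / (Rabs M + 1)) by (eapply Rlt_le_trans; [apply Hz|apply Rmin_r]).
  assert (Hn : z <> 0) by (apply Cmod_gt_0; lra).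
  replace (omega z) with (omega z * / z * z)%C by now field.
  rewrite Cmod_mult. specialize (HM z ltac:(lra)).
  apply Rle_lt_trans with ((Rabs M + 1) * Cmod z).
  - apply Rmult_le_compat_r; [lra|]. pose proof (Rle_abs M). lra.
  - replace eps with ((Rabs M + 1) * (eps / (Rabs M + 1))) by (field; lra).
    now apply Rmult_lt_compat_l.
Qed.

(** From g(w) = b_0 + w g_1(w) one gets
    H_k g(omega) = b_0 H_k + z H_(k+1) g_1(omega).  Comparing the expansions at 0
    gives d_0 = b_0 c_0 and the expansion of H_(k+1) g_1(omega). *)
Lemma twisted_compose_step (W omega g : C -> C) (b c d : nat -> C) (k n : nat) :
  analytic_at W 0 -> analytic_at omega 0 -> omega 0 = 0 ->
  (forall w, unit_disk w -> C_pseries_sum b w (g w)) ->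
  expands (S n) c (twisted W omega k) ->
  expands (S n) d (fun z => twisted W omega k z * g (omega z))%C ->
  d 0%nat = (b 0%nat * c 0%nat)%C /\
  exists g1 : C -> C,
    (forall w, unit_disk w -> C_pseries_sum (fun j => b (S j)) w (g1 w)) /\
    expands n (fun j => - b 0%nat * c (S j) + d (S j))%C
      (fun z => twisted W omega (S k) z * g1 (omega z))%C.
Proof.
  intros HW Ho H0 Hb (C1 & HC & HC1) (F1 & HF & HF1).
  destruct (C_pseries_tail_fun unit_disk b g Hb) as [g1 Hg].
  assert (Hg1 := fun w Hw => proj2 (Hg w Hw)). simpl in Hg1.
  destruct (expands_twisted 0 W omega (S k) HW Ho H0) as [c' [MT HT]].
  destruct (C_pseries_bounded _ g1 1 Rlt_0_1 Hg1) as [Mg HMg].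
  destruct (expands_bounded _ _ _ HC1) as [MC HMC].
  assert (Hsmall := omega_small omega (1 / 4) Ho H0 ltac:(lra)).
  assert (Hid : near0 (fun z =>
     d 0%nat + z * F1 z
     = b 0%nat * c 0%nat
       + z * (b 0%nat * C1 z + twisted W omega (S k) z * g1 (omega z)))%C).
  { apply (near0_impl _ _ (near0_and _ _ Hsmall (near0_and _ _ HC HF))).
    intros z Hz (Hs & E1 & E2). rewrite <- E2.
    rewrite (proj1 (Hg (omega z) ltac:(unfold unit_disk; lra))).
    transitivity (b 0%nat * (c 0%nat + z * C1 z)
                  + z * (twisted W omega (S k) z * g1 (omega z)))%C; [|ring].
    rewrite <- E1. unfold twisted. rewrite Cpow_S. field. exact Hz. }
  assert (E0 : d 0%nat = (b 0%nat * c 0%nat)%C).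
  { refine (expands_unique _ _ F1 _ (expands_bounded _ _ _ HF1) _ Hid).
    exists (Cmod (b 0%nat) * MC + MT * Mg).
    apply (near0_impl _ _ (near0_and _ _ Hsmall (near0_and _ _ HT HMC))).
    intros z _ (H1 & H2 & H3). eapply Rle_trans; [apply Cmod_triangle|].
    rewrite !Cmod_mult. apply Rplus_le_compat.
    - apply Rmult_le_compat_l; [apply Cmod_ge_0|exact H3].
    - apply Rmult_le_compat; try apply Cmod_ge_0; [exact H2|now apply HMg]. }
  split; [exact E0|]. exists g1. split; [exact Hg1|].
  refine (expands_ext n _ _ _ _ (expands_lin n (- b 0%nat)%C _ _ C1 F1 HC1 HF1)).
  apply (near0_impl _ _ Hid). intros z Hz E. rewrite E0 in E.
  replace (F1 z) with (/ z * (b 0%nat * c 0%nat + z * F1 z - b 0%nat * c 0%nat))%C by (field; exact Hz).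
  rewrite E. field. exact Hz.
Qed.

(** Induction on n for all k and all shifts s at once.  By [twisted_compose_step],
    |d_(m+1)| <= |b_0| |c_(m+1)| + |e_(m+1)|, where the e_(m+1) are handled by the
    induction hypothesis for (k+1, s+1), and
    |c_0| x_s + sum |c_(m+1)| x_(m+1+s) <= x_s (|c_0| + (1 - |c_0|)) = x_s
    because |c_(m+1)| <= 2 (1 - |c_0|) and 2 sum x_(m+1) <= 1. *)
Lemma majorant_comparison (x : nat -> R) (W omega : C -> C) (n : nat) :
  (forall k, 0 <= x k) ->
  (forall m k, x (m + k)%nat <= x m * x k) ->
  (forall m, 2 * sum_n (fun j => x (S j)) m <= 1) ->
  class_B W -> class_B omega -> omega 0 = 0 ->
  forall (s k : nat) (b d : nat -> C) (g : C -> C),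
  (forall w, unit_disk w -> C_pseries_sum b w (g w)) ->
  expands (S n) d (fun z => twisted W omega k z * g (omega z))%C ->
  sum_n (fun m => Cmod (d m) * x (m + s)%nat) n <=
  sum_n (fun m => Cmod (b m) * x (m + s)%nat) n.
Proof.
  intros Hx0 Hxm Hx1 HW Ho H0.
  assert (AW : analytic_at W 0) by apply HW, unit_disk_0.
  assert (Ao : analytic_at omega 0) by apply Ho, unit_disk_0.
  assert (Hc : forall k m, exists c, expands (S (S m)) c (twisted W omega k) /\
    forall j, (1 <= j <= S m)%nat -> 2 * Cmod (c 0%nat) + Cmod (c j) <= 2).
  { intros k m. destruct (expands_twisted (S (S m)) W omega k AW Ao H0) as [c Hc].
    exists c. split; [exact Hc|]. intros j Hj.
    apply (twisted_coef_bound W omega c k j HW Ho); [lia|].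
    apply (expands_le (S j) (S (S m))); [lia|exact Hc]. }
  induction n as [|n IH]; intros s k b d g Hb Hd.
  - destruct (Hc k 0%nat) as (c & Hexp & Hcj). specialize (Hcj 1%nat ltac:(lia)).
    pose proof (Cmod_ge_0 (c 1%nat)).
    destruct (twisted_compose_step W omega g b c d k 0 AW Ao H0 Hb
      (expands_pred _ _ _ Hexp) Hd) as [E _].
    rewrite !sum_O, E, Cmod_mult. apply Rmult_le_compat_r; [apply Hx0|].
    rewrite <- (Rmult_1_r (Cmod (b 0%nat))) at 2.
    apply Rmult_le_compat_l; [apply Cmod_ge_0|lra].
  - destruct (Hc k n) as (c & Hexp & Hcj).
    assert (Hc01 : Cmod (c 0%nat) <= 1).
    { specialize (Hcj 1%nat ltac:(lia)). pose proof (Cmod_ge_0 (c 1%nat)). lra. }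
    destruct (twisted_compose_step W omega g b c d k (S n) AW Ao H0 Hb Hexp Hd)
      as (E & g1 & Hg1 & He).
    specialize (IH (S s) (S k) _ _ g1 Hg1 He). cbv beta in IH.
    rewrite !sum_n_first. change (@plus R_AbelianMonoid) with Rplus.
    set (B := Cmod (b 0%nat)) in *. set (c0 := Cmod (c 0%nat)) in *.
    assert (HB : 0 <= B) by apply Cmod_ge_0.
    rewrite E, Cmod_mult. fold B c0.
    assert (Hd1 : sum_n (fun m => Cmod (d (S m)) * x (S m + s)%nat) n
      <= sum_n (fun m => B * (2 * (1 - c0)) * x s * x (S m)) n
         + sum_n (fun m => Cmod (- b 0%nat * c (S m) + d (S m)) * x (m + S s)%nat) n).
    { rewrite <- sum_n_Radd. apply sum_n_Rle. intros m Hm.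
      replace (m + S s)%nat with (S m + s)%nat by lia.
      specialize (Hcj (S m) ltac:(lia)). fold c0 in Hcj.
      pose proof (Hxm (S m) s) as Hxs. pose proof (Hx0 (S m + s)%nat) as Hxp.
      set (y := x (S m + s)%nat) in *.
      replace (d (S m)) with (b 0%nat * c (S m) + (- b 0%nat * c (S m) + d (S m)))%C at 1 by ring.
      eapply Rle_trans; [apply Rmult_le_compat_r; [exact Hxp|apply Cmod_triangle]|].
      rewrite Rmult_plus_distr_r. apply Rplus_le_compat_r.
      rewrite Cmod_mult. fold B.
      replace (B * (2 * (1 - c0)) * x s * x (S m)) with (B * (2 * (1 - c0)) * (x (S m) * x s)) by ring.
      apply Rmult_le_compat; [|exact Hxp| |exact Hxs].
      - apply Rmult_le_pos; [exact HB|apply Cmod_ge_0].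
      - apply Rmult_le_compat_l; lra. }
    rewrite sum_n_Rmult_l in Hd1.
    assert (Hb1 : sum_n (fun m => Cmod (b (S m)) * x (m + S s)%nat) n
                  = sum_n (fun m => Cmod (b (S m)) * x (S m + s)%nat) n).
    { apply sum_n_ext. intros m. do 2 f_equal. lia. }
    rewrite Hb1 in IH.
    assert (Hmid : B * (2 * (1 - c0)) * x s * sum_n (fun m => x (S m)) n <= B * (1 - c0) * x s).
    { specialize (Hx1 n).
      replace (B * (2 * (1 - c0)) * x s * sum_n (fun m => x (S m)) n)
        with (B * (1 - c0) * x s * (2 * sum_n (fun m => x (S m)) n)) by ring.
      rewrite <- (Rmult_1_r (B * (1 - c0) * x s)) at 2.
      apply Rmult_le_compat_l; [|exact Hx1].
      apply Rmult_le_pos; [apply Rmult_le_pos; lra|apply Hx0]. }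
    replace (0 + s)%nat with s by lia.
    lra.
Qed.

(** * The comparison of majorant series *)

Lemma partial_sum_le_Series (u : nat -> R) (n : nat) :
  (forall k, 0 <= u k) -> ex_series u -> sum_n u n <= Series u.
Proof.
  intros Hu Hex.
  refine (is_lim_seq_incr_compare (sum_n u) (Series u) _ _ n).
  - exact (Series_correct u Hex).
  - intros m. rewrite sum_n_Rplus. specialize (Hu (S m)). lra.
Qed.

Lemma class_F_ex_series (phi : nat -> R -> R) (r : R) :
  class_F phi -> Ico01 r -> ex_series (fun n => phi n r).
Proof.
  intros (_ & _ & H) Hr. destruct (H r Hr) as (delta & Hdelta & HC).
  exists (real (Lim_seq (sum_n (fun n => phi n r)))).
  refine (proj1 (is_lim_seq_spec (sum_n (fun n => phi n r))
                   (Finite (Lim_seq (sum_n (fun n => phi n r))))) _).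
  intros eps.
  destruct (HC eps) as [N HN]. exists N. intros n Hn.
  apply (HN n Hn r). split; [exact Hr|].
  rewrite Rminus_diag, Rabs_R0. exact Hdelta.
Qed.

(** The root gives information only on (0,R]; the bound at r = 0 follows since
    each partial sum is continuous there. *)
Lemma class_F_sum_le_at_0 (phi : nat -> R -> R) (R0 : R) (n : nat) :
  class_F phi -> 0 < R0 < 1 ->
  (forall x, 0 < x < R0 -> 2 * sum_n (fun j => phi (S j) x) n <= 1) ->
  2 * sum_n (fun j => phi (S j) 0) n <= 1.
Proof.
  intros (_ & Hc & _) HR H.
  assert (H0 : Ico01 0) by (unfold Ico01; lra).
  assert (Hlim : filterlim (fun x => sum_n (fun j => phi (S j) x) n)
     (within Ico01 (locally 0)) (locally (sum_n (fun j => phi (S j) 0) n))).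
  { clear H. induction n as [|n IH].
    - rewrite sum_O. apply filterlim_ext with (phi 1%nat).
      + intros x. now rewrite sum_O.
      + now apply Hc.
    - rewrite sum_n_Rplus.
      apply filterlim_ext with (fun x => sum_n (fun j => phi (S j) x) n + phi (S (S n)) x).
      + intros x. now rewrite sum_n_Rplus.
      + eapply filterlim_comp_2; [exact IH|exact (Hc (S (S n)) 0 H0)|].
        apply (filterlim_plus (V := R_NormedModule)). }
  apply le_epsilon. intros eps Heps.
  assert (He : 0 < eps / 2) by lra.
  destruct (proj1 (filterlim_locally _ _) Hlim (mkposreal _ He)) as [d Hd].
  pose proof (cond_pos d) as Hdpos.
  set (y := Rmin (d / 2) (R0 / 2)).
  assert (Hy : 0 < y /\ y <= d / 2 /\ y <= R0 / 2).
  { unfold y. split; [apply Rmin_pos; lra|]. split; [apply Rmin_l|apply Rmin_r]. }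
  specialize (Hd y). simpl in Hd.
  assert (Hb : ball (0 : R) d y).
  { change (Rabs (y - 0) < d). rewrite Rminus_0_r, Rabs_pos_eq; lra. }
  specialize (Hd Hb ltac:(unfold Ico01; lra)).
  change (Rabs (sum_n (fun j => phi (S j) y) n - sum_n (fun j => phi (S j) 0) n) < eps / 2) in Hd.
  apply Rabs_def2 in Hd. specialize (H y ltac:(lra)). lra.
Qed.

(** The terms b_k (3/4)^k are bounded, and 1/2 = (3/4) (2/3). *)
Lemma ex_series_geometric_majorant (b : nat -> C) (x : nat -> R) (l : C) :
  C_pseries_sum b (RtoC (3 / 4)) l ->
  (forall k, 0 <= x k <= (/ 2) ^ k) ->
  ex_series (fun k => Cmod (b k) * x k).
Proof.
  intros Hb Hx. destruct (C_pseries_terms_bounded _ _ _ Hb) as [M HM].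
  rewrite Cmod_R, Rabs_pos_eq in HM by lra.
  apply (ex_series_le (V := R_CompleteNormedModule) _ (fun k => M * (2 / 3) ^ k)).
  - intros k. change (Rabs (Cmod (b k) * x k) <= M * (2 / 3) ^ k).
    pose proof (Cmod_ge_0 (b k)) as Hbk.
    rewrite Rabs_pos_eq by (apply Rmult_le_pos; [exact Hbk|apply Hx]).
    apply Rle_trans with (Cmod (b k) * (/ 2) ^ k); [now apply Rmult_le_compat_l; [|apply Hx]|].
    replace (/ 2) with (3 / 4 * (2 / 3)) by field.
    rewrite Rpow_mult_distr, <- Rmult_assoc.
    apply Rmult_le_compat_r; [apply pow_le; lra|apply HM].
  - apply (ex_series_scal_l M (fun k => (2 / 3) ^ k)).
    apply ex_series_geom. rewrite Rabs_pos_eq; lra.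
Qed.

Theorem theorem3 :
  forall (phi : nat -> R -> R) (f g : C -> C) (a b : nat -> C) (R0 : R),
    class_F phi ->
    (forall r : R, Ico01 r -> phi 0%nat r = 1) ->
    (forall (m n : nat) (r : R), Ico01 r ->
       phi (m + n)%nat r <= phi m r * phi n r) ->
    analytic_in_disk f ->
    analytic_in_disk g ->
    (forall z : C, unit_disk z -> C_pseries_sum a z (f z)) ->
    (forall z : C, unit_disk z -> C_pseries_sum b z (g z)) ->
    quasi_subordinate f g ->
    minimal_positive_root phi R0 ->
    (forall x : R, 0 < x < R0 -> 2 * Phi1 phi x < 1) ->
    forall r : R, 0 <= r <= R0 ->
      ex_series (fun k => Cmod (a k) * phi k r) /\
      ex_series (fun k => Cmod (b k) * phi k r) /\
      Series (fun k => Cmod (a k) * phi k r) <=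
        Series (fun k => Cmod (b k) * phi k r).
Proof.
  intros phi f g a b R0 HF Hphi0 Hsub _ _ Ha Hb Hq [[HR0 Hroot] _] Hbelow r Hr.
  assert (Hdom : forall x, 0 <= x <= R0 -> Ico01 x) by (intros x Hx; unfold Ico01; lra).
  assert (Hpos : forall n x, Ico01 x -> 0 <= phi n x) by apply HF.
  assert (Hpart : forall n x, 0 < x <= R0 -> 2 * sum_n (fun j => phi (S j) x) n <= 1).
  { intros n x Hx. assert (HxD : Ico01 x) by (apply Hdom; lra).
    assert (Hle : sum_n (fun j => phi (S j) x) n <= Phi1 phi x).
    { apply partial_sum_le_Series; [intros k; now apply Hpos|].
      apply (ex_series_incr_1 (fun k => phi k x)). now apply class_F_ex_series. }
    destruct (Rle_lt_or_eq_dec x R0 ltac:(lra)) as [Hlt| ->]; [|lra].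
    specialize (Hbelow x ltac:(lra)). lra. }
  assert (Hsum : forall n, 2 * sum_n (fun j => phi (S j) r) n <= 1).
  { intros n. destruct (Rle_lt_or_eq_dec 0 r ltac:(lra)) as [H|<-]; [apply Hpart; lra|].
    apply (class_F_sum_le_at_0 phi R0 n HF HR0). intros x Hx. apply Hpart. lra. }
  assert (HrD : Ico01 r) by now apply Hdom.
  assert (Hgeom : forall k, 0 <= phi k r <= (/ 2) ^ k).
  { intros k. split; [now apply Hpos|]. induction k as [|k IH].
    - rewrite Hphi0 by exact HrD. simpl. lra.
    - specialize (Hsum 0%nat). rewrite sum_O in Hsum.
      eapply Rle_trans; [exact (Hsub 1%nat k r HrD)|].
      simpl. apply Rmult_le_compat; try (now apply Hpos); lra. }
  assert (H34 : unit_disk (RtoC (3 / 4))).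
  { unfold unit_disk. rewrite Cmod_R, Rabs_pos_eq; lra. }
  assert (Exa := ex_series_geometric_majorant a (fun k => phi k r) _ (Ha _ H34) Hgeom).
  assert (Exb := ex_series_geometric_majorant b (fun k => phi k r) _ (Hb _ H34) Hgeom).
  split; [exact Exa|]. split; [exact Exb|].
  destruct Hq as (W & omega & HW & Ho & H0 & Hfg).
  (* f itself is H_0 g(omega), so the comparison applies with k = s = 0. *)
  assert (Hcmp : forall n, sum_n (fun k => Cmod (a k) * phi k r) n
                           <= sum_n (fun k => Cmod (b k) * phi k r) n).
  { intros n.
    pose proof (majorant_comparison (fun k => phi k r) W omega n
      (fun k => Hpos k r HrD) (fun m k => Hsub m k r HrD) Hsum HW Ho H0
      0%nat 0%nat b a g Hb) as H.
    assert (Hexp : expands (S n) a (fun z => twisted W omega 0 z * g (omega z))%C).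
    { apply (expands_ext _ _ f).
      - exists 1. split; [lra|]. intros z Hz. rewrite Hfg by (unfold unit_disk; lra).
        unfold twisted. simpl. ring.
      - apply (expands_pseries _ _ _ 1); [lra|exact Ha]. }
    specialize (H Hexp).
    rewrite (sum_n_ext (fun k => Cmod (a k) * phi (k + 0)%nat r)
                        (fun k => Cmod (a k) * phi k r)) in H
      by (intros k; now rewrite Nat.add_0_r).
    rewrite (sum_n_ext (fun k => Cmod (b k) * phi (k + 0)%nat r)
                        (fun k => Cmod (b k) * phi k r)) in H
      by (intros k; now rewrite Nat.add_0_r).
    exact H. }
  exact (is_lim_seq_le _ _ (Finite (Series (fun k => Cmod (a k) * phi k r)))
           (Finite (Series (fun k => Cmod (b k) * phi k r)))
           Hcmp (Series_correct _ Exa) (Series_correct _ Exb)).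
Qed.
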